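(* There exist a binomial domain $U$ and a filtered $\psi$-ring structure $\{\psi^p_{univ}\}_{p\text{ prime}}$ over the power series ring $U[[x]]$ such that the following statements hold. (1) Each $\psi^p_{univ}$ restricts to the identity map on $U$. (2) For every ring $R$ with $\mathbf{Z}\subseteq R\subseteq\mathbf{Q}$, the natural map $$\Psi_R\colon \mathrm{Ring}(U,R)\longrightarrow\{\text{filtered }\lambda\text{-ring structures over }R[[x]]\},\qquad f\longmapsto\{f_*(\psi^p_{univ})\},$$ is an isomorphism (i.e. a bijection).
   Context: All rings are commutative with unit; $\mathrm{Ring}(U,R)$ is the set of ring homomorphisms $U\to R$. A binomial domain is a $\mathbf{Z}$-torsionfree ring $B$ such that $\binom{b}{n}=\frac{b(b-1)\cdots(b-n+1)}{n!}\in B\otimes\mathbf{Q}$ lies in $B$ for all $b\in B$ and all positive integers $n$. A filtered ring is a ring $R$ with a decreasing sequence of ideals $R=I^0\supset I^1\supset\cdots$ with $I^nI^m\subseteq I^{n+m}$; filtered ring homomorphisms are ring maps preserving the filtrations. The indeterminate $x$ is given a fixed positive filtration $d$, and power series rings $R[[x]]$ carry the $x$-adic filtration (so $I^n$ is generated by $x^{\lceil n/d\rceil}$). A $\psi$-ring is a ring $R$ with ring homomorphisms $\psi^p\colon R\to R$, $p$ prime, such that $\psi^p(r)\equiv r^p\pmod{pR}$ for all $r\in R$, and $\psi^p\psi^q=\psi^q\psi^p$ for all primes $p,q$. A filtered $\psi$-ring is a $\psi$-ring which is also a filtered ring, with all $\psi^p$ filtered ring homomorphisms. A filtered $\lambda$-ring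 is a filtered ring which is a $\lambda$-ring (in the sense of Grothendieck, originally called special $\lambda$-ring) all of whose filtration ideals are closed under $\lambda^i$ for $i>0$. Its Adams operations are defined by the Newton formula $\psi^n(r)-\lambda^1(r)\psi^{n-1}(r)+\cdots+(-1)^{n-1}\lambda^{n-1}(r)\psi^1(r)+(-1)^nn\lambda^n(r)=0$. For $R$ between $\mathbf{Z}$ and $\mathbf{Q}$, a filtered $\lambda$-ring structure on $R[[x]]$ is identified with the filtered $\psi$-ring structure given by its Adams operations $\psi^p$, $p$ prime (by a theorem of Wilkerson this is a one-to-one correspondence). Push-forward: if $f\colon U\to R$ is a ring map, $f_*(\psi^p_{univ})$ is the unique filtered ring endomorphism of $R[[x]]$ which restricts to the identity on $R$ and sends $x$ to the power series obtained by applying $f$ to each coefficient of $\psi^p_{univ}(x)$. *)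

(* Defs.v *)
From HB Require Import structures.
From mathcomp Require Import all_boot all_order all_algebra all_fingroup.
From mathcomp Require Import boolp.
From mathcomp Require Import mpoly zify.

Set Implicit Arguments.
Unset Strict Implicit.
Unset Printing Implicit Defensive.

Import GRing.Theory.
Local Open Scope ring_scope.

Section UniversalPolynomials.

(* P(u_1, ..., u_n; v_1, ..., v_n), for a polynomial P in n + n variables. *)
Definition eval2 (n : nat) (P : {mpoly int[n + n]}) (A : comNzRingType)
    (u v : 'I_n -> A) : A :=
  mmap intr (fun k => match split k with inl i => u i | inr j => v j end) P.

(* P_n, written in the elementary symmetric functions of x_1, ..., x_n and of  *)
(* y_1, ..., y_n, is the coefficient of t^n in the product of all the factors *)
(* 1 + x_i y_j t. As indices start at 0, the variable of index k stands for   *)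
(* the elementary symmetric function of degree k + 1.                         *)
Definition lambda_prod_spec (n : nat) (P : {mpoly int[n + n]}) : bool :=
  let x i : {mpoly int[n + n]} := 'X_(lshift n i) in
  let y j : {mpoly int[n + n]} := 'X_(rshift n j) in
  eval2 P (fun k => mmap intr x (mesym n int k.+1))
          (fun k => mmap intr y (mesym n int k.+1))
  == (\prod_(i < n) \prod_(j < n) (1 + (x i * y j)%:P * 'X))`_n.

(* P_{n,m}, in terms of the elementary symmetric functions of x_1, ..., x_nm, *)
(* is the coefficient of t^n in the product of the 1 + x_{i_1}...x_{i_m} t    *)
(* over i_1 < ... < i_m.                                                      *)
Definition lambda_comp_spec (n m : nat) (P : {mpoly int[n * m]}) : bool :=
  P \mPo [tuple (mesym (n * m) int k.+1) | k < n * m]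
  == (\prod_(S : {set 'I_(n * m)} | #|S| == m)
        (1 + (\prod_(i in S) 'X_i)%:P * 'X))`_n.

Lemma mmap_eq (n : nat) (R S : nzRingType) (f : R -> S) (h1 h2 : 'I_n -> S) p :
  h1 =1 h2 -> mmap f h1 p = mmap f h2 p.
Proof. by move=> e; apply: eq_bigr => m _; rewrite (mmap1_eq _ e). Qed.

Lemma rmorph_mmap (n : nat) (R : nzRingType) (S T : comNzRingType)
    (f : {rmorphism R -> S}) (g : {rmorphism S -> T}) (h : 'I_n -> S) p :
  g (mmap f h p) = mmap (g \o f) (g \o h) p.
Proof.
rewrite /mmap rmorph_sum; apply: eq_bigr => m _.
rewrite rmorphM /mmap1 rmorph_prod; congr (_ * _).
by apply: eq_bigr => i _; rewrite rmorphXn.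
Qed.

Lemma mmap_comp_mpoly (n k : nat) (R : comNzRingType) (S : comNzRingType)
    (f : {rmorphism R -> S}) (h : 'I_k -> S) (lq : n.-tuple {mpoly R[k]}) p :
  mmap f h (p \mPo lq) = mmap f (fun i => mmap f h (tnth lq i)) p.
Proof.
rewrite /comp_mpoly rmorph_mmap /mmap.
by apply: eq_bigr => m _ /=; rewrite mmapC.
Qed.

Lemma mmap_mesym (n k : nat) (S : comNzRingType) (h : 'I_n -> S) :
  mmap intr h (mesym n int k)
  = \sum_(H : {set 'I_n} | #|H| == k) \prod_(i in H) h i.
Proof.
rewrite /mesym rmorph_sum; apply: eq_bigr => H _; rewrite rmorph_prod.
by apply: eq_bigr => i _ /=; rewrite mmapX mmap1U.
Qed.

Lemma lambda_comp_exists n m : exists P, @lambda_comp_spec n m P.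
Proof.
set F := \prod_(S : {set 'I_(n * m)} | #|S| == m)
           (1 + (\prod_(i in S) ('X_i : {mpoly int[n * m]}))%:P * 'X).
have symF s : map_poly (msym s) F = F.
  rewrite rmorph_prod /= [RHS](reindex_inj (imset_inj (@perm_inj _ s))) /=.
  apply: eq_big => [S|S _]; first by rewrite card_imset //; exact: perm_inj.
  rewrite rmorphD rmorph1 rmorphM /= map_polyX map_polyC /= rmorph_prod.
  rewrite big_imset /=; last by move=> i j _ _; exact: perm_inj.
  congr (1 + (_)%:P * _); apply: eq_bigr => i _.
  by rewrite msymX; congr 'X_[_]; apply/mnmP => j;
     rewrite mnmE !mnm1E (can2_eq (permK s) (permKV s)).
have symFn : F`_n \is symmetric.
  by apply/issymP => s; rewrite -{2}(symF s) coef_map.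
have [t [tE _]] := sym_fundamental symFn.
by exists t; apply/eqP.
Qed.

Lemma prod_1DM (n : nat) (A : comNzRingType) (z : A) (y : 'I_n -> A) :
  \prod_(j < n) (1 + z * y j) =
  1 + \sum_(k < n) mmap intr y (mesym n int k.+1) * z ^+ k.+1.
Proof.
under eq_bigr do rewrite addrC.
rewrite bigA_distr.
rewrite (partition_big (fun H : {set 'I_n} => inord #|H| : 'I_n.+1) predT) //=.
have E (k : 'I_n.+1) (H : {set 'I_n}) : (inord #|H| == k) = (#|H| == k :> nat).
  by rewrite -val_eqE /= inordK // ltnS -[n in leqRHS]card_ord max_card.
rewrite big_ord_recl; congr (_ + _).
  rewrite (big_pred1 set0) => [|H]; last by rewrite E cards_eq0.
  by rewrite big1 // => i _; rewrite in_set0.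
apply: eq_bigr => k _; rewrite mmap_mesym mulr_suml.
apply: eq_big => [H|H]; first by rewrite E.
rewrite E => /eqP cH; rewrite -big_mkcond /= big_split /= mulrC.
by rewrite prodr_const cH.
Qed.

Lemma sym_prod_exists (n : nat) (C : comNzRingType) (c : 'I_n -> C) :
  exists t : {mpoly C[n]}, t \mPo [tuple mesym n C k.+1 | k < n] =
    (\prod_(i < n)
       (1 + \sum_(k < n) ((c k)%:MP * 'X_i ^+ k.+1)%:P * 'X^(k.+1)))`_n.
Proof.
set G := \prod_(i < n) _.
have symG s : map_poly (msym s) G = G.
  rewrite rmorph_prod /= [RHS](reindex_inj (@perm_inj _ s)) /=.
  apply: eq_bigr => i _; rewrite rmorphD rmorph1 rmorph_sum /=.
  congr (1 + _); apply: eq_bigr => k _.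
  rewrite rmorphM /= map_polyXn map_polyC /= msymM rmorphXn /=.
  have -> : msym s (c k)%:MP = (c k)%:MP.
    by rewrite -[(c k)%:MP]mulr1 mul_mpolyC msymZ msym1.
  suff -> : msym s 'X_i = 'X_(s i) :> {mpoly C[n]} by [].
  rewrite msymX; congr 'X_[_]; apply/mnmP => j.
  by rewrite mnmE !mnm1E (can2_eq (permK s) (permKV s)).
have symGn : G`_n \is symmetric.
  by apply/issymP => s; rewrite -{2}(symG s) coef_map.
have [t [tE _]] := sym_fundamental symGn.
by exists t.
Qed.

Lemma mmap_sym_prod (n : nat) (C D : comNzRingType) (c : 'I_n -> C)
    (g : {rmorphism C -> D}) (x y : 'I_n -> D) :
  (forall k : 'I_n, g (c k) = mmap intr y (mesym n int k.+1)) ->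
  mmap g x ((\prod_(i < n)
       (1 + \sum_(k < n) ((c k)%:MP * 'X_i ^+ k.+1)%:P * 'X^(k.+1)))`_n)
  = (\prod_(i < n) \prod_(j < n) (1 + (x i * y j)%:P * 'X))`_n.
Proof.
move=> gc; rewrite -coef_map; congr (fun p : {poly D} => p`_n).
rewrite rmorph_prod; apply: eq_bigr => i _.
under [RHS]eq_bigr do rewrite polyCM mulrAC.
rewrite prod_1DM rmorphD rmorph1 rmorph_sum; congr (1 + _).
apply: eq_bigr => k _; rewrite rmorphM /= map_polyXn map_polyC /=.
have -> : mmap g x ((c k)%:MP * 'X_i ^+ k.+1)
    = mmap intr y (mesym n int k.+1) * x i ^+ k.+1.
  rewrite rmorphM rmorphXn /=; congr (_ * _ ^+ _); last by rewrite mmapX mmap1U.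
  by rewrite mmapC; exact: gc.
rewrite exprMn polyCM rmorphXn /= mulrA; congr (_ * _ * _).
by rewrite !mmap_mesym rmorph_sum; apply: eq_bigr => H _; rewrite rmorph_prod.
Qed.

Lemma lambda_prod_exists n : exists P, @lambda_prod_spec n P.
Proof.
have [t tE] := @sym_prod_exists n {mpoly int[n]} (fun k => 'X_k).
pose x (i : 'I_n) : {mpoly int[n + n]} := 'X_(lshift n i).
pose y (i : 'I_n) : {mpoly int[n + n]} := 'X_(rshift n i).
exists (mmap (mmap intr y) x t); apply/eqP; rewrite -/x -/y.
set u := fun k => mmap intr x _; set v := fun k => mmap intr y _.
pose h k := match split k with inl i => u i | inr j => v j end.
have -> : eval2 (mmap (mmap intr y) x t) u v = mmap (mmap intr v) u t.
  rewrite /eval2 -/h (@rmorph_mmap _ _ _ _ (mmap intr y) (mmap intr h)).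
  rewrite /mmap; apply: eq_bigr => m _; congr (_ * _).
    rewrite [LHS](@rmorph_mmap _ _ _ _ intr (mmap intr h)) /mmap.
    apply: eq_bigr => m' _; rewrite /= rmorph_int; congr (_ * _).
    apply: eq_bigr => i _ /=; rewrite mmapX mmap1U.
    by rewrite /h -[rshift n i]/(unsplit (inr i)) unsplitK.
  apply: eq_bigr => i _ /=; rewrite mmapX mmap1U.
  by rewrite /h -[lshift n i]/(unsplit (inl i)) unsplitK.
have -> : mmap (mmap intr v) u t = mmap (mmap intr v) x
    (t \mPo [tuple mesym n {mpoly int[n]} k.+1 | k < n]).
  rewrite mmap_comp_mpoly; apply: mmap_eq => i.
  rewrite tnth_mktuple /u mmap_mesym /mesym rmorph_sum; apply: eq_bigr => H _.
  by rewrite rmorph_prod; apply: eq_bigr => j _ /=; rewrite mmapX mmap1U.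
rewrite tE; apply: mmap_sym_prod => k /=.
by rewrite mmapX mmap1U.
Qed.

End UniversalPolynomials.

(* The choices below are no choices: elementary symmetric functions are       *)
(* algebraically independent, so each specification has a unique solution.    *)
Definition lambda_prod_poly (n : nat) : {mpoly int[n + n]} :=
  xchoose (lambda_prod_exists n).

Definition lambda_comp_poly (n m : nat) : {mpoly int[n * m]} :=
  xchoose (lambda_comp_exists n m).

Lemma lambda_prod_polyP n : lambda_prod_spec (lambda_prod_poly n).
Proof. exact: xchooseP. Qed.

Lemma lambda_comp_polyP n m : lambda_comp_spec (lambda_comp_poly n m).
Proof. exact: xchooseP. Qed.

Record filtration (A : comNzRingType) := Filtration {
  filt_ideal :> nat -> A -> Prop;
  filt_zero : forall n, filt_ideal n 0;
  filt_add : forall n a b,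
    filt_ideal n a -> filt_ideal n b -> filt_ideal n (a + b);
  filt_mul : forall n a b, filt_ideal n b -> filt_ideal n (a * b);
  filt_full : forall a, filt_ideal 0 a;
  filt_decr : forall n a, filt_ideal n.+1 a -> filt_ideal n a;
  filt_prod : forall n m a b,
    filt_ideal n a -> filt_ideal m b -> filt_ideal (n + m)%N (a * b)
}.

Definition filtered_morphism (A B : comNzRingType) (F : filtration A)
    (G : filtration B) (f : A -> B) : Prop :=
  [/\ zmod_morphism f, monoid_morphism f & forall n a, F n a -> G n (f a)].

(* The values psi n for n not prime are irrelevant. *)
Definition filtered_psi_structure (A : comNzRingType) (F : filtration A)
    (psi : nat -> A -> A) : Prop :=
  [/\ forall p, prime p -> filtered_morphism F F (psi p),
      forall p, prime p -> forall r, exists a, psi p r - r ^+ p = p%:R * a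
    & forall p q, prime p -> prime q ->
        forall r, psi p (psi q r) = psi q (psi p r)].

(* Special lambda-rings; lambda_ring lam says that the operations lam n, for  *)
(* n >= 0, form such a structure.                                             *)
Record lambda_ring (A : comNzRingType) (lam : nat -> A -> A) : Prop := {
  lambda0 : forall r, lam 0 r = 1;
  lambda1 : forall r, lam 1 r = r;
  lambda_unit : forall n, (1 < n)%N -> lam n 1 = 0;
  lambdaD : forall n r s,
    lam n (r + s) = \sum_(i < n.+1) lam i r * lam (n - i)%N s;
  lambdaM : forall n r s,
    lam n (r * s) =
    eval2 (lambda_prod_poly n) (fun k => lam k.+1 r) (fun k => lam k.+1 s);
  lambda_comp : forall n m r,
    lam n (lam m r) = mmap intr (fun k => lam k.+1 r) (lambda_comp_poly n m)
}.

Record filtered_lambda_structure (A : comNzRingType) (F : filtration A) :=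
  FilteredLambda {
    lambda_op :> nat -> A -> A;
    lambda_opP : lambda_ring lambda_op;
    lambda_op_filt : forall i n a, (0 < i)%N -> F n a -> F n (lambda_op i a)
  }.

Section Adams.
Variables (A : comNzRingType) (lam : nat -> A -> A).

Fixpoint adams_seq (r : A) (n : nat) : seq A :=
  if n is m.+1 then
    let s := adams_seq r m in
    rcons s (\sum_(i < m) (-1) ^+ i * lam i.+1 r * s`_(m - i.+1)%N
             + (-1) ^+ m * m.+1%:R * lam m.+1 r)
  else [::].

(* Defined for n > 0 only; adams 0 r is the default value 0. *)
Definition adams (n : nat) (r : A) : A := (adams_seq r n)`_n.-1.

Lemma size_adams_seq r n : size (adams_seq r n) = n.
Proof. by elim: n => //= n IHn; rewrite size_rcons IHn. Qed.

Lemma nth_adams_seq r n i : (i < n)%N -> (adams_seq r n)`_i = adams i.+1 r.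
Proof.
elim: n => // n IHn; rewrite ltnS leq_eqVlt => /predU1P[-> //|lt_in].
by rewrite /= nth_rcons size_adams_seq lt_in IHn.
Qed.

(* Newton's formula, which is the definition of the Adams operations. *)
Lemma adams_newton n r : (0 < n)%N ->
  adams n r + \sum_(1 <= i < n) (-1) ^+ i * lam i r * adams (n - i)%N r
  + (-1) ^+ n * n%:R * lam n r = 0.
Proof.
case: n => // n _; rewrite {1}/adams /= nth_rcons size_adams_seq ltnn eqxx.
rewrite big_add1 big_mkord addrAC -addrA [X in _ + X]addrC.
rewrite addrACA -big_split /= big1 => [|i _].
  by rewrite add0r exprS !mulN1r !mulNr addrN.
rewrite exprS mulN1r !mulNr subSS nth_adams_seq.
  by rewrite subnSK ?subrr.
by rewrite ltn_subrL (leq_trans _ (ltn_ord i)).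
Qed.

End Adams.

Record fps (R : Type) := Fps { coefps : nat -> R }.

HB.instance Definition _ (R : Type) := gen_eqMixin (fps R).
HB.instance Definition _ (R : Type) := gen_choiceMixin (fps R).

Section PowerSeries.
Variable R : comNzRingType.
Implicit Types f g h : fps R.

Lemma fpsP f g : coefps f =1 coefps g -> f = g.
Proof. by case: f g => [f] [g] /= /funext->. Qed.

Definition fpsC (c : R) : fps R := Fps (fun n => if n is 0 then c else 0).
Definition fpsX : fps R := Fps (fun n => (n == 1)%:R).

Definition addps f g := Fps (fun n => coefps f n + coefps g n).
Definition oppps f := Fps (fun n => - coefps f n).
Definition mulps f g :=
  Fps (fun n => \sum_(i < n.+1) coefps f i * coefps g (n - i)%N).

Fact addpsA : associative addps.
Proof. by move=> f g h; apply: fpsP => n /=; rewrite addrA. Qed.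
Fact addpsC : commutative addps.
Proof. by move=> f g; apply: fpsP => n /=; rewrite addrC. Qed.
Fact add0ps : left_id (fpsC 0) addps.
Proof. by move=> f; apply: fpsP => -[|n] /=; rewrite add0r. Qed.
Fact addNps : left_inverse (fpsC 0) oppps addps.
Proof. by move=> f; apply: fpsP => -[|n] /=; rewrite addNr. Qed.

HB.instance Definition _ :=
  GRing.isZmodule.Build (fps R) addpsA addpsC add0ps addNps.

Let trunc n f : {poly R} := \poly_(i < n) coefps f i.

Let coef_mul_trunc n k f g : (k < n)%N ->
  coefps (mulps f g) k = (trunc n f * trunc n g)`_k.
Proof.
move=> lt_kn; rewrite coefM; apply: eq_bigr => i _.
have le_ik : (i <= k)%N by rewrite -ltnS.
by rewrite !coef_poly !(leq_ltn_trans _ lt_kn) ?leq_subr.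
Qed.

Let mulpsC : commutative mulps.
Proof.
by move=> f g; apply: fpsP => n; rewrite !(coef_mul_trunc _ _ (ltnSn n)) mulrC.
Qed.

Let mulpsA : associative mulps.
Proof.
move=> f g h; apply: fpsP => n.
rewrite !(coef_mul_trunc _ _ (ltnSn n)).
have E f1 f2 k : (k <= n)%N ->
    (trunc n.+1 (mulps f1 f2))`_k = (trunc n.+1 f1 * trunc n.+1 f2)`_k.
  by move=> le_kn; rewrite coef_poly ltnS le_kn (@coef_mul_trunc n.+1).
transitivity ((trunc n.+1 f * (trunc n.+1 g * trunc n.+1 h))`_n).
  by rewrite !coefM; apply: eq_bigr => i _; rewrite E ?leq_subr.
rewrite mulrA !coefM; apply: eq_bigr => i _.
by rewrite E // -ltnS.
Qed.

Let mul1ps : left_id (fpsC 1) mulps.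
Proof.
move=> f; apply: fpsP => n /=; rewrite big_ord_recl /= mul1r subn0.
by rewrite big1 ?addr0 // => i _; rewrite mul0r.
Qed.

Let mulpsDl : left_distributive mulps addps.
Proof.
move=> f g h; apply: fpsP => n /=; rewrite -big_split.
by apply: eq_bigr => i _; rewrite mulrDl.
Qed.

Let oneps_neq0 : fpsC 1 != 0.
Proof. by apply/eqP => -[/(congr1 (@^~ 0%N))] /eqP; rewrite oner_eq0. Qed.

HB.instance Definition _ := GRing.Zmodule_isComNzRing.Build (fps R)
  mulpsA mulpsC mul1ps mulpsDl oneps_neq0.

(* The variable has filtration d, so the n-th ideal is generated by the power *)
(* of the variable whose exponent is n / d rounded up.                        *)
Definition xadic_ideal (d n : nat) (f : fps R) : Prop :=
  exists g, f = fpsX ^+ ((n + d.-1) %/ d) * g.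

Fact xadic_ideal_sub d n m f : ((n + d.-1) %/ d <= (m + d.-1) %/ d)%N ->
  xadic_ideal d m f -> xadic_ideal d n f.
Proof.
move=> le_nm [g ->]; exists (fpsX ^+ ((m + d.-1) %/ d - (n + d.-1) %/ d) * g).
by rewrite mulrA -exprD subnKC.
Qed.

Fact xadic0 d n : xadic_ideal d n 0.
Proof. by exists 0; rewrite mulr0. Qed.

Fact xadicD d n f g :
  xadic_ideal d n f -> xadic_ideal d n g -> xadic_ideal d n (f + g).
Proof. by move=> [f' ->] [g' ->]; exists (f' + g'); rewrite mulrDr. Qed.

Fact xadicM d n f g : xadic_ideal d n g -> xadic_ideal d n (f * g).
Proof. by move=> [g' ->]; exists (f * g'); rewrite mulrCA. Qed.

Fact xadicT d f : xadic_ideal d 0 f.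
Proof.
exists f; suff -> : ((0 + d.-1) %/ d = 0)%N by rewrite mul1r.
by case: d => [|d] //=; rewrite divn_small.
Qed.

Fact xadicS d n f : xadic_ideal d n.+1 f -> xadic_ideal d n f.
Proof. by apply: xadic_ideal_sub; rewrite leq_div2r ?leq_add2r. Qed.

Fact xadicX d n m f g :
  xadic_ideal d n f -> xadic_ideal d m g -> xadic_ideal d (n + m)%N (f * g).
Proof.
move=> [f' ->] [g' ->].
set a := ((n + d.-1) %/ d)%N; set b := ((m + d.-1) %/ d)%N.
suff le_ab : ((n + m + d.-1) %/ d <= a + b)%N.
  exists (fpsX ^+ (a + b - (n + m + d.-1) %/ d) * (f' * g')).
  by rewrite mulrACA -exprD !mulrA -exprD subnKC.
case: d @a @b => [|d] //=; rewrite -ltnS -addSn.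
rewrite ltn_divLR //.
have := ltn_ceil (n + d) (ltn0Sn d); have := ltn_ceil (m + d) (ltn0Sn d).
lia.
Qed.

Definition xadic (d : nat) : filtration (fps R) :=
  Filtration (xadic0 d) (@xadicD d) (@xadicM d) (xadicT d) (@xadicS d)
    (@xadicX d).

End PowerSeries.

Definition map_fps (R S : Type) (f : R -> S) (a : fps R) : fps S :=
  Fps (f \o coefps a).

(* phi is the unique filtered endomorphism described by these conditions. *)
Definition is_pushforward (d : nat) (U R : comNzRingType)
    (f : {rmorphism U -> R}) (psi : fps U -> fps U) (phi : fps R -> fps R) :
    Prop :=
  [/\ filtered_morphism (xadic R d) (xadic R d) phi,
      forall r, phi (fpsC r) = fpsC r
    & phi (fpsX R) = map_fps f (psi (fpsX U))].

(* As B is torsionfree it embeds in its tensor product with the rationals,    *)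
(* where the product below, divided by n!, lies in B iff it is n! times an    *)
(* element of B.                                                              *)
Definition binomial_domain (B : comNzRingType) : Prop :=
  (forall (n : nat) (b : B), (0 < n)%N -> b *+ n = 0 -> b = 0) /\
  (forall (b : B) (n : nat), (0 < n)%N ->
     exists c : B, c *+ n`! = \prod_(i < n) (b - i%:R)).

(* Main.v *)
Require Import Defs.
From HB Require Import structures.
From mathcomp Require Import all_boot all_order all_algebra.
From mathcomp Require Import boolp mpoly qpoly finfield zify ring.

Set Implicit Arguments.
Unset Strict Implicit.
Unset Printing Implicit Defensive.

Import GRing.Theory.
Local Open Scope ring_scope.

(* Proof. A rational point is a commuting family (psi^p(x)) of series over Q  *)
(* without constant term. Let U be the binomial ring of functions on rational *)
(* points generated by the coordinates b_(p,i), where                         *)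
(*   psi^p(x) = x^p + p (b_(p,0) + b_(p,1) x + ...).                          *)
(* Working inside functions on points makes the commutation relations hold in *)
(* U, and evaluating at a point whose coordinates lie in R gives a morphism   *)
(* from U to R since R is itself binomial; conversely a morphism into a       *)
(* torsion-free ring is determined by the coordinates. In a binomial domain   *)
(* b^p = b mod p, hence substituting psi^p(x) for x lifts the Frobenius as    *)
(* soon as psi^p(x) = x^p mod p. The correspondence between psi- and          *)
(* lambda-structures is proved by comparing Newton's relations after splitting*)
(* the lambda-series into linear factors over an extension; integrality of    *)
(* the lambda-operations is Dwork's lemma on Witt coordinates.                *)

(** A filtered endomorphism of R[[x]] fixing R is substitution of a series without constant term
    ([filtered_morphism_compps]), and for R inside Q every ring endomorphism of R[[x]] fixes R
    ([rat_subring_endo_id]). A structure on R[[x]] thus amounts to series congruent to x^p mod p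
    that commute under composition. U represents such families: commutation holds in U because it
    can be tested at rational points, [universal_hom_exists] turns a family over R into a morphism
    by evaluation, and [universal_hom_ext] recovers a morphism from its family. Conversely
    [compps_frobenius] makes such a family a psi-structure when b^p = b mod p for constants, which
    [binomial_domain_fermat] supplies for U and for R.

    The passage between psi and lambda rests on Newton's relations. [elemsym_splitting] factors a
    truncated lambda-series in an extension that preserves torsion-freeness and reflects
    divisibility by integers; there the universal polynomials become symmetric functions of products
    of roots. This yields [adams_comp] and [adams_frobenius] in one direction and [psi_lambda_ring]
    in the other, where [witt_decomposition] provides integrality. Uniqueness is
    [lambda_ring_uniq]. *)

Lemma mul_prime_ind (P : nat -> Prop) :
  P 1%N -> (forall p n, prime p -> (0 < n)%N -> P n -> P (p * n)%N) ->
  forall n, (0 < n)%N -> P n.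
Proof.
move=> P1 PM; elim/ltn_ind => -[//|[//|n]] IH _.
have pp : prime (pdiv n.+2) by apply: pdiv_prime.
have /dvdnP[k] := pdiv_dvd n.+2; move: (pdiv _) pp => p pp nE.
have k0 : (0 < k)%N by case: k nE.
rewrite nE mulnC; apply: PM => //; apply: IH => //.
by rewrite nE; have := prime_gt1 pp; nia.
Qed.

(** * Newton's relations *)

Definition torsion_free (A : comNzRingType) : Prop :=
  forall (n : nat) (a : A), (0 < n)%N -> a *+ n = 0 -> a = 0.

Lemma torsion_free_mulI (A : comNzRingType) (n : nat) :
  torsion_free A -> (0 < n)%N -> injective (fun a : A => n%:R * a).
Proof.
move=> tfA n0 a b /= /eqP; rewrite -subr_eq0 -mulrBr mulr_natl => /eqP /(tfA _
  _ n0).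
by move/eqP; rewrite subr_eq0 => /eqP.
Qed.

(* Newton's relation up to degree N, where a_k stands for the elementary      *)
(* symmetric function and p_k, k > 0, for the power sum of degree k.          *)
Definition newton (A : comNzRingType) (N : nat) (a p : nat -> A) : Prop :=
  forall n, (n <= N)%N ->
  n%:R * a n = \sum_(i < n) (-1) ^+ i * a (n - i.+1)%N * p i.+1.

Section Newton.
Variable A : comNzRingType.
Implicit Types (a b p q : nat -> A).

Lemma newtonW M N a p : (M <= N)%N -> newton N a p -> newton M a p.
Proof. by move=> MN nw n nM; apply: nw; apply: leq_trans MN. Qed.

Lemma newton_recl N a p n : a 0%N = 1 -> newton N a p -> (n < N)%N ->
  p n.+1 = (-1) ^+ n *
    (n.+1%:R * a n.+1 - \sum_(i < n) (-1) ^+ i * a (n - i)%N * p i.+1).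
Proof.
move=> a0 nw nN; rewrite nw // big_ord_recr /= subnn a0 mulr1.
under eq_bigr do rewrite subSS.
by rewrite addrAC subrr add0r mulrA -expr2 sqrr_sign mul1r.
Qed.

Lemma newton_step N a b p q n :
  a 0%N = 1 -> b 0%N = 1 -> newton N a p -> newton N b q -> (n < N)%N ->
  (forall k, (k <= n.+1)%N -> a k = b k) ->
  (forall k, (k < n)%N -> p k.+1 = q k.+1) -> p n.+1 = q n.+1.
Proof.
move=> a0 b0 na nb nN ab pq.
rewrite (newton_recl a0 na nN) (newton_recl b0 nb nN) ab //; congr (_ * (_ -
  _)).
by apply: eq_bigr => i _; rewrite pq // ab // (leq_trans (leq_subr _ _)).
Qed.

Lemma newton_power_sums_uniq N a b p q :
  a 0%N = 1 -> newton N a p -> newton N b q ->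
  (forall k, (k <= N)%N -> a k = b k) ->
  forall k, (k < N)%N -> p k.+1 = q k.+1.
Proof.
move=> a0 na nb ab; have b0 : b 0%N = 1 by rewrite -ab.
elim/ltn_ind => k IH kN; apply: (newton_step a0 b0 na nb kN).
  by move=> j jk; apply: ab; apply: leq_trans jk _.
by move=> j jk; apply: IH => //; apply: ltn_trans kN.
Qed.

Lemma newton_elementary_uniq N a b p q : torsion_free A ->
  a 0%N = 1 -> b 0%N = 1 -> newton N a p -> newton N b q ->
  (forall k, (k < N)%N -> p k.+1 = q k.+1) ->
  forall k, (k <= N)%N -> a k = b k.
Proof.
move=> tfA a0 b0 na nb pq; elim/ltn_ind => -[|k] IH kN; first by rewrite a0.
apply: (torsion_free_mulI tfA (ltn0Sn k)); rewrite /= na // nb //.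
apply: eq_bigr => i _; rewrite pq ?(leq_trans (ltn_ord i)) // IH //.
  by rewrite subSS ltnS leq_subr.
by rewrite (leq_trans _ kN) // leq_subr.
Qed.

(* If p and q agree below n, then so do a and b, which makes one relation in  *)
(* degree n sufficient.                                                       *)
Lemma newton_power_sum_eq n a b p q : torsion_free A ->
  a 0%N = 1 -> b 0%N = 1 -> newton n.+1 a p -> newton n.+1 b q ->
  a n.+1 = b n.+1 -> (forall k, (k < n)%N -> p k.+1 = q k.+1) ->
  p n.+1 = q n.+1.
Proof.
move=> tfA a0 b0 na nb abn pq; apply: (newton_step a0 b0 na nb) => // k.
rewrite leq_eqVlt => /orP[/eqP -> //|]; rewrite ltnS.
by apply: (newton_elementary_uniq tfA a0 b0 _ _ pq); apply: (newtonW (leqnSn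
  n)).
Qed.

Lemma eq_newton N a b p q : (forall k, (k <= N)%N -> a k = b k) ->
  (forall k, (k < N)%N -> p k.+1 = q k.+1) -> newton N a p -> newton N b q.
Proof.
move=> ab pq nw n nN; rewrite -ab // nw //; apply: eq_bigr => i _.
by rewrite pq ?ab // ?(leq_trans (ltn_ord i)) // (leq_trans (leq_subr _ _)).
Qed.

(** With [theta] the operator t d/dt, Newton's relations in all degrees say theta(a) = a * psum(p):
    up to signs, p is the logarithmic derivative of a. *)
Let theta (f : fps A) : fps A := Fps (fun n => n%:R * coefps f n).
Let psum p : fps A := Fps (fun n => if n is m.+1 then (-1) ^+ m * p n else 0).

Let newtonE a p :
  (forall N, newton N a p) <-> theta (Fps a) = Fps a * psum p.
Proof.
have E n : coefps (Fps a * psum p) n =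
    \sum_(i < n) (-1) ^+ i * a (n - i.+1)%N * p i.+1.
  rewrite mulrC [LHS]/=  big_ord_recl /= mul0r add0r; apply: eq_bigr => i _.
  by rewrite mulrAC.
split=> [nw | e N n _]; first by apply: fpsP => n; rewrite E; exact: (nw n).
by rewrite -E -e.
Qed.

(** Logarithmic derivatives turn products into sums, by the Leibniz rule for [theta]. *)
Lemma newtonM a b p q :
  (forall N, newton N a p) -> (forall N, newton N b q) ->
  forall N, newton N (fun n => \sum_(i < n.+1) a i * b (n - i)%N)
    (fun n => p n + q n).
Proof.
move=> /newtonE na /newtonE nb; apply/newtonE.
have -> : Fps (fun n => \sum_(i < n.+1) a i * b (n - i)%N) = Fps a * Fps b by
  [].
have -> : psum (fun n => p n + q n) = psum p + psum q.
  by apply: fpsP => -[|n] /=; rewrite ?addr0 // mulrDr.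
have -> : theta (Fps a * Fps b) = theta (Fps a) * Fps b + Fps a * theta (Fps b).
  apply: fpsP => n /=; rewrite mulr_sumr -big_split; apply: eq_bigr => i _ /=.
  have -> : n%:R = i%:R + (n - i)%:R :> A by rewrite -natrD subnKC // -ltnS.
  ring.
rewrite na nb; ring.
Qed.

Lemma newton_poly1 N : newton N (fun n => (1 : {poly A})`_n) (fun _ => 0).
Proof.
move=> n _; rewrite big1 => [|i _]; last by rewrite mulr0.
by rewrite coef1; case: n => [|n] /=; rewrite ?mul0r ?mulr0.
Qed.

Lemma newton_poly_prod (I : Type) (r : seq I) (P : pred I) (f : I -> {poly A})
    (p : I -> nat -> A) :
  (forall i, P i -> forall N, newton N (fun n => (f i)`_n) (p i)) ->
  forall N, newton N (fun n => (\prod_(i <- r | P i) f i)`_n)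
                     (fun n => \sum_(i <- r | P i) p i n).
Proof.
move=> nf; elim: r => [|i r IH] N.
  by apply: (eq_newton _ _ (@newton_poly1 N)) => k _; rewrite big_nil.
case Pi: (P i); last by apply: (eq_newton _ _ (IH N)) => k _; rewrite big_cons
  Pi.
apply: (eq_newton _ _ (@newtonM _ _ _ _ (nf i Pi) IH N)) => k _; rewrite
  big_cons Pi //.
by rewrite coefM.
Qed.

(** From theta(1 + c t^d) / (1 + c t^d) = - d sum_(j > 0) (- c)^j t^(d j), up to the sign (-1)^(n-1)
    carried by the n-th power sum. *)
Lemma newton_binomial (c : A) d N : (0 < d)%N ->
  newton N (fun n => (1 + c%:P * 'X^d : {poly A})`_n)
    (fun n => if (d %| n)%N then (-1) ^+ n * d%:R * (- c) ^+ (n %/ d) else 0).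
Proof.
move=> d0 n _.
pose g k : A := if (d %| k)%N then - d%:R * (- c) ^+ (k %/ d) else 0.
have coefE k : (1 + c%:P * 'X^d : {poly A})`_k = (k == 0%N)%:R + c * (k ==
  d)%:R.
  by rewrite coefD coef1 coefCM coefXn.
case: n => [|n]; first by rewrite big_ord0 mul0r.
rewrite coefE add0r.
(* Only the coefficients of degree 0 and d contribute, and [g] is the power sum with its sign
   absorbed; above degree d the two surviving terms cancel. *)
rewrite (eq_bigr (fun i : 'I_n.+1 =>
    (n - i == 0)%N%:R * g i.+1 + (n - i == d)%N%:R * (c * g i.+1))); last first.
  move=> i _; rewrite coefE subSS /g; case: ifP => _; last by rewrite !mulr0
    addr0.
  by rewrite exprS; move: ((-1) ^+ i) (sqrr_sign A i) => s s2; ring: s2.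
rewrite big_split /= big_ord_recr /= subnn eqxx mul1r.
rewrite [X in X + g _]big1 => [|i _]; last by rewrite subn_eq0 leqNgt ltn_ord
  mul0r.
rewrite add0r; case: (ltngtP n.+1 d) => [nd | dn | e].
- rewrite big1 => [|i _].
    by rewrite /g gtnNdvd // addr0 !mulr0.
  by rewrite ltn_eqF ?mul0r // (leq_ltn_trans (leq_subr _ _)) // ltnW.
- have lt : (n - d < n.+1)%N by rewrite ltnS leq_subr.
  rewrite (bigD1 (Ordinal lt)) //= big1 => [|i ne]; last first.
    case: eqP => [e|]; last by rewrite mul0r.
    by case/eqP: ne; apply: val_inj; rewrite /= -e subKn // -ltnS.
  rewrite subKn // eqxx mul1r addr0 -subSn // /g dvdn_subl ?dvdnn // 1?ltnW //.
  case: ifP => [/dvdnP[k nE]|_]; last by rewrite !mulr0 addr0.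
  case: k nE => [|k] nE; first by move: dn; rewrite nE mul0n ltn0.
  by rewrite nE mulnK // mulSn addKn mulnK // exprS; ring.
- rewrite big1 => [|i _].
    by rewrite /g -e dvdnn divnn expr1 mulr1; ring.
  by rewrite ltn_eqF ?mul0r // -e ltnS leq_subr.
Qed.

Lemma newton_linear_prod (I : finType) (P : pred I) (z : I -> A) N :
  newton N (fun n => (\prod_(i | P i) (1 + (z i)%:P * 'X : {poly A}))`_n)
    (fun n => \sum_(i | P i) z i ^+ n).
Proof.
apply: newton_poly_prod => i _ M.
apply: (eq_newton _ _ (@newton_binomial (z i) 1 M isT)) => k _ //.
by rewrite dvd1n divn1 mulr1 -exprMn mulrNN mul1r.
Qed.

End Newton.

(** * Splitting a series into linear factors *)

Definition elemsym (A : comNzRingType) (I : finType) (x : I -> A) (k : nat) : A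
  :=
  (\prod_i (1 + (x i)%:P * 'X : {poly A}))`_k.

(* The case n = 0 of the second clause is injectivity. *)
Definition pure_extension (A B : comNzRingType) (iota : A -> B) : Prop :=
  (torsion_free A -> torsion_free B) /\
  (forall (n : nat) a b, iota a = n%:R * b -> exists c, a = n%:R * c).

Lemma pure_extension_inj (A B : comNzRingType) (iota : {rmorphism A -> B}) :
  pure_extension iota -> injective iota.
Proof.
move=> [_ pure] a b ab; have [|c] := pure 0%N (a - b) 0.
  by rewrite rmorphB ab subrr mul0r.
by rewrite mul0r => /eqP; rewrite subr_eq0 => /eqP.
Qed.

Lemma pure_extension_comp (A B C : comNzRingType) (f : A -> B) (g : B -> C) :
  pure_extension f -> pure_extension g -> pure_extension (g \o f).
Proof.
move=> [tf pf] [tg pg]; split=> [/tf/tg // | n a b /pg[c]]; exact: pf.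
Qed.

(** In A[X]/(h), h monic, elements are given by their coefficients below the degree of h, so
    torsion-freeness is inherited from A; purity follows by comparing constant coefficients. *)
Lemma adjoin_root (A : comNzRingType) (h : {poly A}) :
  h \is monic -> (1 < size h)%N ->
  exists (B : comNzRingType) (iota : {rmorphism A -> B}) (y : B),
    pure_extension iota /\ (map_poly iota h).[y] = 0.
Proof.
move=> mh sh; have hE : mk_monic h = h by rewrite /mk_monic sh mh.
pose iota : {rmorphism A -> {poly %/ h}} := in_qpoly h \o polyC.
have iota0 a : (iota a)`_0 = a.
  by rewrite in_qpoly_small ?coefC // (leq_ltn_trans (size_polyC_leq1 a))
    ?size_mk_monic_gt1.
have coefMn (q : {poly %/ h}) (n k : nat) : (q *+ n : {poly %/ h})`_k = q`_k *+
  n.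
  by elim: n => [|n IH]; rewrite ?mulr0n ?coef0 // !mulrS poly_of_qpolyD coefD
    IH.
exists {poly %/ h}, iota, (in_qpoly h 'X); split; first split.
- move=> tfA n q n0 q0; apply/npolyP => k /=; rewrite coef0; apply: (tfA n) =>
    //.
  by rewrite -coefMn q0 coef0.
- move=> n a b /(congr1 (fun q : {poly %/ h} => q`_0)).
  by rewrite iota0 mulr_natl coefMn => ->; exists b`_0; rewrite mulr_natl.
- have -> : (map_poly iota h).[in_qpoly h 'X] = in_qpoly h h.
    rewrite (horner_coef_wide _ (size_poly _ _)) -[X in _ = in_qpoly h X]coefK.
    rewrite [in RHS]poly_def rmorph_sum; apply: eq_bigr => i _ /=.
    by rewrite coef_poly ltn_ord -mul_polyC rmorphM rmorphXn.
  by apply: val_inj; rewrite /= hE Pdiv.RingMonic.rmodpp.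
Qed.

Lemma elemsym0 (A : comNzRingType) (I : finType) (x : I -> A) : elemsym x 0 = 1.
Proof.
by rewrite /elemsym coef0_prod big1 // => i _; rewrite coefD coef1 coefMX /=
  addr0.
Qed.

Lemma elemsym_rmorph (A B : comNzRingType) (f : {rmorphism A -> B}) (I :
  finType)
    (x : I -> A) k :
  f (elemsym x k) = elemsym (f \o x) k.
Proof.
rewrite /elemsym -coef_map rmorph_prod; congr (fun p : {poly B} => p`_k);
  apply: eq_bigr => i _.
by rewrite rmorphD rmorph1 rmorphM /= map_polyC map_polyX.
Qed.

Lemma newton_elemsym (A : comNzRingType) (I : finType) (x : I -> A) N :
  newton N (elemsym x) (fun k => \sum_i x i ^+ k).
Proof. exact: newton_linear_prod. Qed.

Lemma elemsym_large (A : comNzRingType) n (x : 'I_n -> A) k :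
  (n < k)%N -> elemsym x k = 0.
Proof.
move=> nk; rewrite /elemsym nth_default //; apply: leq_trans nk; elim: n x =>
  [|n IH] x.
  by rewrite big_ord0 size_poly1.
rewrite big_ord_recl; apply: leq_trans (size_polyMleq _ _) _.
have q_le := IH (fun i => x (lift ord0 i)).
have p_le : (size (1 + (x ord0)%:P * 'X : {poly A})%R <= 2)%N.
  by rewrite addrC -[1]polyC1 size_MXaddC; case: ifP => // _; rewrite ltnS
    size_polyC_leq1.
by rewrite -subn1 leq_subLR; exact: leq_add p_le q_le.
Qed.

Lemma elemsymS (A : comNzRingType) n (x : 'I_n -> A) (y : A) k :
  elemsym (fun i : 'I_n.+1 => if unlift ord0 i is Some j then x j else y) k.+1 =
  elemsym x k.+1 + y * elemsym x k.
Proof.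
rewrite /elemsym big_ord_recl unlift_none mulrDl mul1r coefD -mulrA coefCM
  coefXM.
rewrite (eq_bigr (fun i => 1 + (x i)%:P * 'X)) // => i _.
by rewrite liftK.
Qed.

(* With h the reversal of a and y a root of h, the series a is divisible by   *)
(* 1 - y t modulo t^(N+2), and the quotient m has degree N.                   *)
Lemma elemsym_splitting (N : nat) (A : comNzRingType) (a : nat -> A) : a 0%N =
  1 ->
  exists (B : comNzRingType) (iota : {rmorphism A -> B}) (x : 'I_N -> B),
    pure_extension iota /\ forall k, (k <= N)%N -> iota (a k) = elemsym x k.
Proof.
elim: N A a => [|N IH] A a a0.
  exists A, idfun, (fun _ => 0); split; first by split=> // n b c bE; exists c.
  by case=> // _; rewrite a0 elemsym0.
pose h := \poly_(i < N.+2) a (N.+1 - i)%N.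
have sh : size h = N.+2 by rewrite size_poly_eq // subnn a0 oner_eq0.
have mh : h \is monic by rewrite monicE lead_coefE sh coef_poly ltnSn subnn a0.
have [|B [f [y [pf hy]]]] := adjoin_root mh; first by rewrite sh.
pose m k := \sum_(i < k.+1) f (a i) * y ^+ (k - i).
have mS k : m k.+1 = f (a k.+1) + y * m k.
  rewrite /m big_ord_recr /= subnn mulr1 addrC mulr_sumr; congr (_ + _).
  apply: eq_bigr => i _; have ik : (i <= k)%N by rewrite -ltnS.
  by rewrite subSn // exprS mulrCA.
have m0 : m 0%N = 1 by rewrite /m big_ord1 a0 rmorph1 mulr1.
have mN : m N.+1 = 0.
  have sfh : (size (map_poly f h) <= N.+2)%N by rewrite -sh size_poly.
  rewrite -hy (horner_coef_wide _ sfh) /m (reindex_inj rev_ord_inj).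
  apply: eq_bigr => i _; rewrite coef_map coef_poly ltn_ord /= subSS.
  by rewrite subKn // -ltnS.
have [C [g [x [pg gE]]]] := IH B m m0.
exists C, (g \o f), (fun i => if unlift ord0 i is Some j then x j else - g y).
split=> [|[|k] kN]; first exact: pure_extension_comp.
  by rewrite elemsym0 a0 rmorph1.
rewrite elemsymS /= -(gE k kN) mulNr -rmorphM.
suff -> : elemsym x k.+1 = g (m k.+1) by rewrite -rmorphB mS addrK.
move: kN; rewrite ltnS leq_eqVlt => /orP[/eqP -> | kN]; last by rewrite gE.
by rewrite mN rmorph0 elemsym_large.
Qed.

(** * Universal polynomials at the roots *)

Lemma eq_elemsym (A : comNzRingType) (I : finType) (x y : I -> A) k :
  x =1 y -> elemsym x k = elemsym y k.
Proof.
by move=> xy; congr (fun p : {poly A} => p`_k); apply: eq_bigr => i _; rewrite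
  xy.
Qed.

Lemma elemsym_sum (A : comNzRingType) n (x : 'I_n -> A) k :
  elemsym x k = \sum_(H : {set 'I_n} | #|H| == k) \prod_(i in H) x i.
Proof.
rewrite /elemsym; under eq_bigr do rewrite addrC.
rewrite bigA_distr coef_sum [RHS]big_mkcond; apply: eq_bigr => H _.
rewrite -big_mkcond /= big_split /= prodr_const -rmorph_prod coefCM coefXn
  eq_sym.
by case: eqP; rewrite ?mulr1 ?mulr0.
Qed.

Lemma mmap_mesym_elemsym (A : comNzRingType) n (x : 'I_n -> A) k :
  mmap intr x (mesym n int k) = elemsym x k.
Proof. by rewrite mmap_mesym elemsym_sum. Qed.

Lemma rmorph_mmap_intr (n : nat) (S T : comNzRingType) (g : {rmorphism S -> T})
    (h : 'I_n -> S) (p : {mpoly int[n]}) :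
  g (mmap intr h p) = mmap intr (g \o h) p.
Proof.
rewrite (@rmorph_mmap _ _ _ _ intr g); apply: eq_bigr => m _ /=.
by rewrite rmorph_int.
Qed.

Lemma eval2_rmorph (n : nat) (S T : comNzRingType) (g : {rmorphism S -> T})
    (u v : 'I_n -> S) (P : {mpoly int[n + n]}) :
  g (eval2 P u v) = eval2 P (g \o u) (g \o v).
Proof.
by rewrite /eval2 rmorph_mmap_intr; apply: mmap_eq => k /=; case: split.
Qed.

Lemma eq_eval2 (n : nat) (A : comNzRingType) (u u' v v' : 'I_n -> A) P :
  u =1 u' -> v =1 v' -> eval2 P u v = eval2 P u' v'.
Proof. by move=> uE vE; apply: mmap_eq => k; case: split. Qed.

(** The specification is a polynomial identity in two families of roots, so it can be evaluated at
    any x and y. *)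
Lemma lambda_prod_polyE (n : nat) (A : comNzRingType) (x y : 'I_n -> A) :
  eval2 (lambda_prod_poly n) (fun k => elemsym x k.+1) (fun k => elemsym y
    k.+1) =
  elemsym (fun ij : 'I_n * 'I_n => x ij.1 * y ij.2) n.
Proof.
pose h k := match split k with inl i => x i | inr j => y j end.
have hl i : mmap intr h 'X_(lshift n i) = x i.
  by rewrite mmapX mmap1U /h -[lshift n i]/(unsplit (inl i)) unsplitK.
have hr i : mmap intr h 'X_(rshift n i) = y i.
  by rewrite mmapX mmap1U /h -[rshift n i]/(unsplit (inr i)) unsplitK.
have /eqP/(congr1 (mmap intr h)) := lambda_prod_polyP n; rewrite eval2_rmorph.
rewrite (@eq_eval2 _ _ _ (fun k => elemsym x k.+1) _ (fun k => elemsym y k.+1)).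
- move=> ->.
  rewrite -coef_map rmorph_prod; congr (fun p : {poly A} => p`_n).
  rewrite -(pair_bigA _ (fun i j => 1 + (x i * y j)%:P * 'X)) /=.
  apply: eq_bigr => i _; rewrite rmorph_prod; apply: eq_bigr => j _.
  by rewrite rmorphD rmorph1 rmorphM /= map_polyX map_polyC /= rmorphM /= hl hr.
- move=> k /=; rewrite mmap_mesym_elemsym elemsym_rmorph.
  by apply: eq_elemsym => i /=; rewrite hl.
- move=> k /=; rewrite mmap_mesym_elemsym elemsym_rmorph.
  by apply: eq_elemsym => i /=; rewrite hr.
Qed.

Lemma lambda_comp_polyE (n m : nat) (A : comNzRingType) (x : 'I_(n * m) -> A) :
  mmap intr (fun k : 'I_(n * m) => elemsym x k.+1) (lambda_comp_poly n m) =
  (\prod_(S : {set 'I_(n * m)} | #|S| == m)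
     (1 + (\prod_(i in S) x i)%:P * 'X : {poly A}))`_n.
Proof.
have /eqP/(congr1 (mmap intr x)) := lambda_comp_polyP n m.
rewrite mmap_comp_mpoly => e; rewrite -[LHS]/(mmap intr _ _).
transitivity (mmap intr (fun i : 'I_(n * m) => mmap intr x (tnth
    [tuple mesym (n * m) int k.+1 | k < n * m] i)) (lambda_comp_poly n m)).
  by apply: mmap_eq => k; rewrite tnth_mktuple mmap_mesym_elemsym.
rewrite e -coef_map rmorph_prod; congr (fun p : {poly A} => p`_n).
apply: eq_bigr => S _; rewrite rmorphD rmorph1 rmorphM /= map_polyX map_polyC
  /=.
by rewrite rmorph_prod; congr (1 + _%:P * _); apply: eq_bigr => i _ /=; rewrite
  mmapX mmap1U.
Qed.

(** * Newton's relations after splitting *)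

Lemma newton_rmorph (A B : comNzRingType) (f : {rmorphism A -> B}) N a p :
  newton N a p -> newton N (f \o a) (f \o p).
Proof.
move=> nw n nN /=; rewrite -[n%:R](rmorph_nat f) -rmorphM nw // rmorph_sum.
by apply: eq_bigr => i _; rewrite !rmorphM rmorph_sign.
Qed.

Lemma newton_splitting (A : comNzRingType) (N : nat) (a p : nat -> A) :
  a 0%N = 1 -> newton N a p ->
  exists (B : comNzRingType) (iota : {rmorphism A -> B}) (x : 'I_N -> B),
    [/\ pure_extension iota,
        forall k, (k <= N)%N -> iota (a k) = elemsym x k
      & forall k, (k < N)%N -> iota (p k.+1) = \sum_i x i ^+ k.+1].
Proof.
move=> a0 na; have [B [iota [x [pure aE]]]] := elemsym_splitting N a0.
exists B, iota, x; split=> //.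
apply: (newton_power_sums_uniq _ (newton_rmorph iota na) (@newton_elemsym _ _ x
  N) aE).
by rewrite /= a0 rmorph1.
Qed.

(** Once the roots x_i of a and y_j of b are adjoined, c consists of the elementary symmetric
    functions of the x_i y_j, whose power sums are p_k q_k. *)
Lemma lambda_prod_splitting (A : comNzRingType) (n : nat) (a b p q : nat -> A) :
  a 0%N = 1 -> b 0%N = 1 -> newton n a p -> newton n b q ->
  exists (B : comNzRingType) (iota : {rmorphism A -> B}) (c s : nat -> B),
    [/\ pure_extension iota, c 0%N = 1, forall N, newton N c s,
        iota (eval2 (lambda_prod_poly n) (fun k => a k.+1) (fun k => b k.+1)) =
          c n
      & forall k, (k < n)%N -> iota (p k.+1 * q k.+1) = s k.+1].
Proof.
move=> a0 b0 na nb.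
have [B [f [x [pf ax px]]]] := newton_splitting a0 na.
have [|C [g [y [pg by_ qy]]]] := @newton_splitting B n (f \o b) (f \o q) _
  (newton_rmorph f nb).
  by rewrite /= b0 rmorph1.
pose z (ij : 'I_n * 'I_n) := g (x ij.1) * y ij.2.
exists C, (g \o f), (elemsym z), (fun k => \sum_i z i ^+ k); split.
- exact: pure_extension_comp.
- exact: elemsym0.
- by move=> N; apply: newton_elemsym.
- rewrite eval2_rmorph -[RHS](lambda_prod_polyE (g \o x) y).
  apply: eq_eval2 => k /=; first by rewrite ax // elemsym_rmorph.
  by rewrite -by_.
- move=> k kn /=; rewrite !rmorphM px // qy // rmorph_sum big_distrlr.
  by rewrite pair_bigA; apply: eq_bigr => ij _; rewrite exprMn rmorphXn.
Qed.

(** Here c and s belong to the products of m distinct roots. Their power sum of degree k is the m-th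
    elementary symmetric function of the x_i^k, a family whose own power sums are the p_(jk). *)
Lemma lambda_comp_splitting (A : comNzRingType) (n m : nat) (a p : nat -> A) :
  a 0%N = 1 -> newton (n * m) a p ->
  exists (B : comNzRingType) (iota : {rmorphism A -> B}) (c s : nat -> B),
    [/\ pure_extension iota, c 0%N = 1, forall N, newton N c s,
        iota (mmap intr (fun k : 'I_(n * m) => a k.+1) (lambda_comp_poly n m))
          = c n
      & forall k, (k < n)%N -> exists b : nat -> B,
          [/\ b 0%N = 1, newton m b (fun j => iota (p (j * k.+1)%N)) & b m = s
            k.+1]].
Proof.
move=> a0 na; have [B [f [x [pf ax px]]]] := newton_splitting a0 na.
exists B, f, (fun k => (\prod_(S : {set 'I_(n * m)} | #|S| == m)
    (1 + (\prod_(i in S) x i)%:P * 'X : {poly B}))`_k),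
  (fun k => \sum_(S : {set 'I_(n * m)} | #|S| == m) (\prod_(i in S) x i) ^+ k);
    split=> //.
- by rewrite coef0_prod big1 // => i _; rewrite coefD coef1 coefMX /= addr0.
- by move=> N; apply: newton_linear_prod.
- rewrite rmorph_mmap_intr -lambda_comp_polyE; apply: mmap_eq => k /=.
  by rewrite ax.
- move=> k kn; exists (elemsym (fun i => x i ^+ k.+1)); split; first exact:
    elemsym0.
    apply: (eq_newton _ _ (@newton_elemsym _ _ (fun i => x i ^+ k.+1) m)) => //
      j jm.
    have -> : (j.+1 * k.+1 = (j * k.+1 + k).+1)%N by rewrite mulSn addnC addnS.
    rewrite px; last by rewrite -addnS -mulSnr mulnC leq_mul.
    by apply: eq_bigr => i _; rewrite -exprM -addnS -mulSnr mulnC.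
  by rewrite elemsym_sum; apply: eq_bigr => S _; rewrite prodrXl.
Qed.

(** Newton's recursion without division writes m! b_m as an integral polynomial in the power sums.
    As [D] depends only on p, values found in different extensions can be compared in A. *)
Lemma newton_factorial (A : comNzRingType) (p : nat -> A) m :
  exists D : A, forall (B : comNzRingType) (iota : {rmorphism A -> B}) b,
    b 0%N = 1 -> newton m b (iota \o p) -> m`!%:R * b m = iota D.
Proof.
elim/ltn_ind: m => -[_|m IH].
  by exists 1 => B iota b b0 _; rewrite b0 rmorph1 mulr1.
have [D DE] := choice (fun i : 'I_m.+1 => IH (m - i)%N (leq_subr _ _ : (m - i <
  m.+1)%N)).
(* The recursion is multiplied by m! = m^_i (m - i)!, whose second factor clears b_(m - i). *)
exists (\sum_(i < m.+1) (-1) ^+ i * (m ^_ i)%:R * D i * p i.+1) => B iota b b0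
  nb.
rewrite factS natrM mulrAC (nb m.+1 (leqnn _)) mulrC mulr_sumr rmorph_sum.
apply: eq_bigr => i _; have im : (i <= m)%N by rewrite -ltnS.
rewrite !rmorphM /= rmorph_sign rmorph_nat -(DE i B iota b b0); last first.
  by apply: newtonW nb; rewrite (leq_trans (leq_subr _ _)).
by rewrite subSS -(ffact_fact im) natrM; ring.
Qed.

(** * Additivity of the p-th power modulo p *)

Lemma prime_dvd_exprD_sub (A : comNzRingType) (p : nat) (a b : A) : prime p ->
  exists c, (a + b) ^+ p = a ^+ p + b ^+ p + p%:R * c.
Proof.
case: p => // p pp; rewrite exprDn big_ord_recl big_ord_recr /= subn0 subnn.
rewrite bin0 binn !expr0 !mulr1n mulr1 mul1r.
suff [c ->] : exists c, \sum_(i < p) (a ^+ (p.+1 - bump 0 i) * b ^+ bump 0 i)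
  *+ 'C(p.+1, bump 0 i) = p.+1%:R * c.
  by exists c; ring.
exists (\sum_(i < p) (a ^+ (p.+1 - bump 0 i) * b ^+ bump 0 i) *+ ('C(p.+1, bump
  0 i) %/ p.+1)).
rewrite mulr_sumr; apply: eq_bigr => i _; rewrite mulr_natl -mulrnA.
by rewrite divnK // prime_dvd_bin // /bump add1n /= ltnS.
Qed.

Lemma prime_dvd_expr_sum_sub (A : comNzRingType) (p : nat) (I : Type) (r : seq
  I)
    (x : I -> A) : prime p ->
  exists c, (\sum_(i <- r) x i) ^+ p = \sum_(i <- r) x i ^+ p + p%:R * c.
Proof.
move=> pp; elim: r => [|i r [c IH]].
  by exists 0; rewrite !big_nil expr0n mulr0 addr0; case: p pp.
have [d dE] := prime_dvd_exprD_sub (x i) (\sum_(i <- r) x i) pp.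
by exists (c + d); rewrite !big_cons dE IH; ring.
Qed.

(** * Adams operations of a lambda-ring *)

(** [adams_newton] with its sum reversed and multiplied by a sign; the leading Adams operation
    becomes the term containing [lam 0 r]. *)
Lemma adams_newtonE (A : comNzRingType) (lam : nat -> A -> A) r N :
  lam 0%N r = 1 -> newton N (lam^~ r) (fun n => adams lam n r).
Proof.
move=> l0 [|n] _; first by rewrite mul0r big_ord0.
have e := adams_newton lam r (ltn0Sn n).
rewrite (reindex_inj rev_ord_inj) big_ord_recl /= !subSS subn0 subnn l0 mulr1.
rewrite (eq_bigr (fun i : 'I_n => (-1) ^+ n * ((-1) ^+ i.+1 * lam i.+1 r *
    adams lam (n - i)%N r))) => [|i _]; last first.
  have nE : n = (n - i.+1 + i.+1)%N by rewrite subnK.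
  rewrite /= /bump /= !add1n !subSS subKn // subnSK //.
  rewrite [X in (-1) ^+ X * (_ * _)]nE exprD.
  by move: ((-1) ^+ i.+1) (sqrr_sign A i.+1) => s s2; ring: s2.
rewrite -mulr_sumr -mulrDr; apply: (can_inj (signrMK n)); rewrite signrMK.
apply: oppr_inj; apply/eqP; rewrite -addr_eq0 addrC; apply/eqP; rewrite -[RHS]e.
rewrite big_add1 big_mkord exprS; under [in RHS]eq_bigr do rewrite subSS.
by rewrite mulrA mulN1r !mulNr.
Qed.

Section AdamsOperations.
Variables (A : comNzRingType) (lam : nat -> A -> A).
Hypotheses (tfA : torsion_free A) (lamP : lambda_ring lam).
Local Notation psi := (adams lam).

Let lam0 r : lam 0%N r = 1 := lambda0 lamP r.

Let lam_newton N r : newton N (lam^~ r) (psi^~ r).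
Proof. exact: adams_newtonE. Qed.

Lemma adamsD n r s : psi n.+1 (r + s) = psi n.+1 r + psi n.+1 s.
Proof.
apply: (@newton_power_sums_uniq _ n.+1 (lam^~ (r + s))
  (fun n => \sum_(i < n.+1) lam i r * lam (n - i)%N s)
  (psi^~ (r + s)) (fun n => psi n r + psi n s)) => //.
- by apply: (@newtonM _ (lam^~ r) (lam^~ s) (psi^~ r) (psi^~ s)) => N; apply:
    lam_newton.
- by move=> k _; exact: (lambdaD lamP).
Qed.

Lemma adams_id r : psi 1 r = r.
Proof.
have := lam_newton r (leqnn 1); rewrite mul1r big_ord1 expr0 mul1r.
by rewrite lam0 mul1r (lambda1 lamP) => {2}->.
Qed.

(** The lambda-series of 1 is 1 + t, with the single root 1. *)
Lemma adams1 n : psi n.+1 1 = 1.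
Proof.
rewrite (@newton_power_sums_uniq _ n.+1 (lam^~ 1) (elemsym (fun _ : 'I_1 => 1))
  (psi^~ 1) (fun k => \sum_(i < 1) 1 ^+ k)) //.
- by rewrite big_ord1 expr1n.
- exact: newton_elemsym.
- case=> [|[|k]] _; first by rewrite elemsym0.
    by rewrite (lambda1 lamP) /elemsym big_ord1 mul1r coefD coef1 coefX add0r.
  by rewrite (lambda_unit lamP) // elemsym_large.
Qed.

(** Induction on n: [lambdaM] matches the two lambda-series in degree n + 1 alone, which suffices by
    [newton_power_sum_eq] once the lower power sums agree. *)
Lemma adamsM n r s : psi n.+1 (r * s) = psi n.+1 r * psi n.+1 s.
Proof.
elim/ltn_ind: n => n IH.
have [B [f [c [t [pf c0 nc cE tE]]]]] := lambda_prod_splitting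
  (lam0 r) (lam0 s) (@lam_newton n.+1 r) (@lam_newton n.+1 s).
apply: (pure_extension_inj pf); rewrite tE //.
apply: (newton_power_sum_eq (pf.1 tfA) _ c0
  (newton_rmorph f (@lam_newton n.+1 (r * s))) (@nc n.+1)).
- by rewrite /= lam0 rmorph1.
- by rewrite /= (lambdaM lamP).
- by move=> k kn; rewrite -tE ?ltnS 1?ltnW //= IH.
Qed.

Lemma adamsB n r s : psi n.+1 (r - s) = psi n.+1 r - psi n.+1 s.
Proof. by apply/eqP; rewrite eq_sym subr_eq -adamsD subrK. Qed.

(** The shift leaves out index 0, where [adams] is the zero default and so is not unital. *)
Definition adamsS n := psi n.+1.

HB.instance Definition _ n := GRing.isZmodMorphism.Build A A (adamsS n)
  (@adamsB n).
HB.instance Definition _ n := GRing.isMonoidMorphism.Build A A (adamsS n)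
  (adams1 n, @adamsM n).

(** After splitting, psi^p(r) is the sum of the x_i^p and r the sum of the x_i; purity brings the
    congruence down to A. *)
Lemma adams_frobenius p r : prime p -> exists a, psi p r - r ^+ p = p%:R * a.
Proof.
move=> pp; have p0 := prime_gt0 pp.
have [B [f [x [pf _ px]]]] := newton_splitting (lam0 r) (@lam_newton p r).
have [c cE] := prime_dvd_expr_sum_sub (index_enum 'I_p) x pp.
apply: (pf.2 _ _ (- c)); rewrite rmorphB rmorphXn -{1}(prednK p0) px ?prednK //.
rewrite -[r in f r]adams_id px //; under [X in X ^+ p]eq_bigr do rewrite expr1.
by rewrite cE; ring.
Qed.

(** Induction on m. Applying psi_k to Newton's relations for r gives power sums psi_k(psi_j r), to
    be compared with those of the k-th powers of the roots, which are psi_(jk) r; they agree for j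
    below the current degree. *)
Lemma adams_comp m k r : (0 < m)%N -> (0 < k)%N -> psi k (psi m r) = psi (m *
  k) r.
Proof.
elim/ltn_ind: m k => -[//|m] IH [//|k] _ _.
have [D DE] := choice (fun k => newton_factorial (fun j => psi (j * k.+1)%N r)
  m.+1).
(* What remains is agreement of the elementary functions in degree m + 1; the factor (m + 1)! lets
   it be stated in A, not in an extension depending on n. *)
suff psiD n : m.+1`!%:R * psi n.+1 (lam m.+1 r) = D n.
  have [B [f [c [t [pf c0 nc cE tE]]]]] :=
    lambda_comp_splitting (n := k.+1) (m := m.+1) (lam0 r) (@lam_newton _ r).
  have [b [b0 nb bE]] := tE k (leqnn _).
  have [b1 n1] : (f \o (adamsS k \o lam^~ r)) 0%N = 1 /\
      newton m.+1 (f \o (adamsS k \o lam^~ r)) (f \o (adamsS k \o psi^~ r)).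
    by split; [rewrite /= lam0 !rmorph1 | do 2!apply: newton_rmorph; apply:
      lam_newton].
  apply: (pure_extension_inj pf).
  apply: (newton_power_sum_eq (pf.1 tfA) b1 b0 n1 nb).
    apply: (torsion_free_mulI (pf.1 tfA) (fact_gt0 m.+1)) => /=.
    by rewrite (DE k B f b b0 nb) -psiD rmorphM rmorph_nat.
  by move=> j jm /=; rewrite -IH.
(* [lambda_comp] matches lam_(n+1)(lam_(m+1) r) with the elementary function of the products of m +
   1 roots, so the power sums agree in degree n + 1 once the lower ones do. *)
elim/ltn_ind: n => n IHn.
have [B [f [c [t [pf c0 nc cE tE]]]]] :=
  lambda_comp_splitting (n := n.+1) (m := m.+1) (lam0 r) (@lam_newton _ r).
have tD j : (j < n.+1)%N -> m.+1`!%:R * t j.+1 = f (D j).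
  by move=> /tE[b [b0 nb <-]]; apply: DE.
apply: (pure_extension_inj pf); rewrite rmorphM rmorph_nat -tD //; congr (_ *
  _).
apply: (newton_power_sum_eq (pf.1 tfA) _ c0
  (newton_rmorph f (@lam_newton n.+1 (lam m.+1 r))) (@nc n.+1)).
- by rewrite /= lam0 rmorph1.
- by rewrite /= (lambda_comp lamP).
- move=> j jn /=; apply: (torsion_free_mulI (pf.1 tfA) (fact_gt0 m.+1)) => /=.
  by rewrite tD ?ltnS 1?ltnW // -IHn // rmorphM rmorph_nat.
Qed.

End AdamsOperations.

Lemma adams_filt (A : comNzRingType) (F : filtration A)
    (L : filtered_lambda_structure F) k n a : F n a -> F n (adams L k.+1 a).
Proof.
move=> Fa; elim/ltn_ind: k => k IH.
have FN b : F n b -> F n (- b) by rewrite -mulN1r; apply: filt_mul.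
rewrite (newton_recl (lambda0 (lambda_opP L) a)
  (adams_newtonE (N := k.+1) (lambda0 (lambda_opP L) a))) //.
apply: filt_mul; apply: filt_add; first by apply/filt_mul/lambda_op_filt.
apply: FN; apply: (big_ind (F n)) => [||i _]; [exact: filt_zero | exact:
  filt_add |].
by apply: filt_mul; apply: IH.
Qed.

(** By [adams_comp] the Adams operations at primes determine all others, and Newton's relations then
    determine the lambda-operations, torsion being absent. *)
Lemma lambda_ring_uniq (A : comNzRingType) (lam mu : nat -> A -> A) :
  torsion_free A -> lambda_ring lam -> lambda_ring mu ->
  (forall p r, prime p -> adams lam p r = adams mu p r) -> lam = mu.
Proof.
move=> tfA lamP muP prE; have adE n : (0 < n)%N -> adams lam n =1 adams mu n.
  elim/mul_prime_ind=> [r | p {}n pp n0 IH r]; first by rewrite !adams_id.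
  by rewrite mulnC -!adams_comp ?(prime_gt0 pp) // prE // IH.
apply/funext => n; apply/funext => r.
apply: (newton_elementary_uniq (N := n) tfA (lambda0 lamP r) (lambda0 muP r)
  (adams_newtonE (lambda0 lamP r)) (adams_newtonE (lambda0 muP r))) => // k _.
exact: adE.
Qed.

(** * Lambda-rings from commuting Frobenius lifts *)

Definition natdvd (A : comNzRingType) (m : nat) (a : A) : Prop :=
  exists c, a = m%:R * c.

Section NatDivides.
Variable A : comNzRingType.
Implicit Types (a b : A) (m n : nat).

Lemma natdvd0 m : natdvd m (0 : A).
Proof. by exists 0; rewrite mulr0. Qed.

Lemma natdvdD m a b : natdvd m a -> natdvd m b -> natdvd m (a + b).
Proof. by case=> c -> [d ->]; exists (c + d); rewrite mulrDr. Qed.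

Lemma natdvdN m a : natdvd m a -> natdvd m (- a).
Proof. by case=> c ->; exists (- c); rewrite mulrN. Qed.

Lemma natdvdB m a b : natdvd m a -> natdvd m b -> natdvd m (a - b).
Proof. by move=> da db; apply: natdvdD da (natdvdN db). Qed.

Lemma natdvdMr m a b : natdvd m a -> natdvd m (a * b).
Proof. by case=> c ->; exists (c * b); rewrite mulrA. Qed.

Lemma natdvdMl m a b : natdvd m b -> natdvd m (a * b).
Proof. by rewrite mulrC; apply: natdvdMr. Qed.

Lemma natdvdM m n a b : natdvd m a -> natdvd n b -> natdvd (m * n) (a * b).
Proof. by case=> c -> [d ->]; exists (c * d); rewrite natrM mulrACA. Qed.

Lemma natdvd_natr m n : (m %| n)%N -> natdvd m (n%:R : A).
Proof. by case/dvdnP=> k ->; exists k%:R; rewrite natrM mulrC. Qed.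

Lemma natdvd_sum (I : Type) (r : seq I) (P : pred I) (f : I -> A) m :
  (forall i, P i -> natdvd m (f i)) -> natdvd m (\sum_(i <- r | P i) f i).
Proof.
by move=> h; apply: (big_ind (natdvd m)) => //; [apply: natdvd0 | apply:
  natdvdD].
Qed.

Lemma natdvd_coprime m n a : (0 < m)%N -> coprime m n ->
  natdvd m a -> natdvd n a -> natdvd (m * n) a.
Proof.
move=> m0 cmn [c ac] [d ad]; have [u v e _] := egcdnP n m0.
exists (u%:R * d - v%:R * c).
have {1}-> : a = (u * m)%N%:R * a - (v * n)%N%:R * a.
  by rewrite e (eqP cmn) natrD; ring.
by rewrite {1}ad ac !natrM; ring.
Qed.

Lemma natdvd_prime_powers n a : (0 < n)%N ->
  (forall q, prime q -> (q %| n)%N -> natdvd (q ^ logn q n) a) -> natdvd n a.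
Proof.
move=> n0 h; rewrite (prod_prime_decomp n0) prime_decompE big_map /=.
have : {subset primes n <= primes n} by [].
elim: {1 2 4}(primes n) (primes_uniq n) => [|q s IH] /=.
  by move=> _ _; rewrite big_nil; exists a; rewrite mul1r.
case/andP=> qs us sn; rewrite big_cons.
have: q \in primes n by rewrite sn ?mem_head.
rewrite mem_primes => /and3P[pq _ qn]; apply: natdvd_coprime.
- by rewrite expn_gt0 prime_gt0.
- rewrite coprime_sym big_seq; apply: (big_ind (fun x => coprime x (q ^ logn q
    n))) => [|x y cx cy|r rs].
  + exact: coprime1n.
  + by rewrite coprimeMl cx.
  + have : r \in primes n by rewrite sn // inE rs orbT.
    rewrite mem_primes => /and3P[pr _ _]; apply/coprimeXl/coprimeXr.
    rewrite prime_coprime // dvdn_prime2 //.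
    by apply: contraNneq qs => <-.
- exact: h.
- by apply: IH => // r rs; apply: sn; rewrite inE rs orbT.
Qed.

Lemma natdvd_subX m a b n : natdvd m (a - b) -> natdvd m (a ^+ n - b ^+ n).
Proof. by move=> d; rewrite subrXX; apply: natdvdMr. Qed.

(** Each q-th power gains a factor q: x^q - y^q is x - y times a sum which is q y^(q-1) modulo x -
    y, hence divisible by q. *)
Lemma natdvd_subX_pow q a b j :
  natdvd q (a - b) -> natdvd (q ^ j.+1) (a ^+ (q ^ j) - b ^+ (q ^ j)).
Proof.
move=> d; elim: j => [|j IH]; first by rewrite expn1 !expr1.
have dj : natdvd q (a ^+ (q ^ j) - b ^+ (q ^ j)) by apply: natdvd_subX.
rewrite expnSr [in a ^+ _]expnSr [in b ^+ _]expnSr !exprM subrXX.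
apply: natdvdM => //; move: (a ^+ _) (b ^+ _) dj => x y dxy.
have -> : \sum_(i < q) x ^+ (q.-1 - i) * y ^+ i =
    \sum_(i < q) (x ^+ (q.-1 - i) - y ^+ (q.-1 - i)) * y ^+ i + q%:R * y ^+
      q.-1.
  have -> : q%:R * y ^+ q.-1 = \sum_(i < q) y ^+ q.-1.
    by rewrite sumr_const card_ord mulr_natl.
  rewrite -big_split; apply: eq_bigr => i _.
  have iq : (i <= q.-1)%N by have := ltn_ord i; lia.
  by rewrite mulrBl -exprD subnK //= subrK.
apply: natdvdD; last by apply: natdvdMr; apply: natdvd_natr.
by apply: natdvd_sum => i _; apply/natdvdMr/natdvd_subX.
Qed.

Lemma natdvd_subX_logn q a b n : (0 < n)%N ->
  natdvd q (a - b) -> natdvd (q ^ (logn q n).+1) (a ^+ n - b ^+ n).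
Proof.
move=> n0 d; have /dvdnP[m nE] := pfactor_dvdnn q n.
rewrite {2 3}nE mulnC !exprM; apply: natdvd_subX; exact: natdvd_subX_pow.
Qed.

End NatDivides.

(** * Multiplicative extension of a commuting family from primes to positive integers *)

Section CommutingFamily.
Variables (A : comNzRingType) (psi : nat -> {rmorphism A -> A}).
Hypothesis psi_comm : forall p q r, prime p -> prime q ->
  psi p (psi q r) = psi q (psi p r).

Fixpoint iter_rmorph (n : nat) (f : {rmorphism A -> A}) : {rmorphism A -> A} :=
  if n is m.+1 then f \o iter_rmorph m f else idfun.

(* The composite of the psi p, for the primes p < N with multiplicity in n.   *)
Fixpoint psi_part (N n : nat) : {rmorphism A -> A} :=
  if N is M.+1 then
    psi_part M n \o (if prime M then iter_rmorph (logn M n) (psi M) else idfun)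
  else idfun.

Definition psi_nat n := psi_part n.+1 n.

Lemma psi_iter p q n r : prime p -> prime q ->
  psi p (iter_rmorph n (psi q) r) = iter_rmorph n (psi q) (psi p r).
Proof. by move=> pp pq; elim: n => //= n <-; rewrite psi_comm. Qed.

Lemma psi_psi_part p N n r : prime p -> psi p (psi_part N n r) = psi_part N n
  (psi p r).
Proof.
move=> pp; elim: N r => //= N IH r; rewrite IH; congr (psi_part _ _ _).
by case: ifP => // pN; rewrite psi_iter.
Qed.

Lemma psi_part_wide N n r : (0 < n)%N -> (n < N)%N -> psi_part N n r = psi_nat
  n r.
Proof.
move=> n0; elim: N => // N IH; rewrite ltnS leq_eqVlt => /orP[/eqP <- //| nN].
by rewrite /= ltn_log0 // if_same IH.
Qed.

Lemma psi_part_mul p N n r : prime p -> (0 < n)%N ->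
  psi_part N (p * n) r = if (p < N)%N then psi p (psi_part N n r) else psi_part
    N n r.
Proof.
move=> pp n0; elim: N r => [|N IH] r //=; rewrite IH.
have lE : prime N -> logn N (p * n) = ((N == p) + logn N n)%N.
  by move=> pN; rewrite (lognM _ (prime_gt0 pp) n0) logn_prime.
case: (ltngtP p N) => [pN | Np | eN].
- rewrite ltnS ltnW //; congr (psi p (psi_part _ _ _)); case: ifP => // /lE ->.
  by rewrite gtn_eqF.
- rewrite ltnS leqNgt Np /=; congr (psi_part _ _ _); case: ifP => // /lE ->.
  by rewrite ltn_eqF.
- by subst p; rewrite ltnSn pp lE // eqxx /= psi_psi_part.
Qed.

Lemma psi_nat1 r : psi_nat 1 r = r.
Proof. by []. Qed.

Lemma psi_natMp p n r : prime p -> (0 < n)%N -> psi_nat (p * n) r = psi p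
  (psi_nat n r).
Proof.
move=> pp n0; rewrite /psi_nat psi_part_mul // ltnS leq_pmulr // psi_part_wide
  //.
by rewrite ltnS leq_pmull // prime_gt0.
Qed.

Lemma psi_natM m n r : (0 < m)%N -> (0 < n)%N -> psi_nat (m * n) r = psi_nat m
  (psi_nat n r).
Proof.
move=> m0 n0; move: m m0; apply: mul_prime_ind => [|p m pp m0 IH].
  by rewrite mul1n psi_nat1.
by rewrite -mulnA !(psi_natMp _ pp) ?muln_gt0 ?m0 // IH.
Qed.

End CommutingFamily.

(** * Witt coordinates and Wilkerson's theorem *)

Section Wilkerson.
Variables (A : comNzRingType) (psi : nat -> {rmorphism A -> A}).
Hypothesis tfA : torsion_free A.
Hypothesis psi1 : forall r, psi 1%N r = r.
Hypothesis psiM : forall m n r, (0 < m)%N -> (0 < n)%N ->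
  psi (m * n)%N r = psi m (psi n r).
Hypothesis psi_frobenius : forall p r, prime p -> natdvd p (psi p r - r ^+ p).

Lemma big_divisors_wide (F : nat -> A) m n : (0 < m)%N -> (m < n)%N ->
  \sum_(1 <= d < n | (d %| m)%N) F d = \sum_(1 <= d < m.+1 | (d %| m)%N) F d.
Proof.
move=> m0 mn; rewrite (big_nat_widen _ m.+1 n) //; apply: eq_bigl => d.
by case: (boolP (d %| m)%N) => // /(dvdn_leq m0); rewrite ltnS.
Qed.

(* Dwork's congruence: with n = q m, expand psi_n = psi_q psi_m by the Witt   *)
(* decomposition in degree m and compare it with that in degree n.            *)
Lemma witt_congruence (w : nat -> A) r n :
  (0 < n)%N ->
  (forall m, (0 < m)%N -> (m < n)%N ->
     psi m r = \sum_(1 <= d < m.+1 | (d %| m)%N) d%:R * w d ^+ (m %/ d)) ->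
  natdvd n (psi n r - \sum_(1 <= d < n | (d %| n)%N) d%:R * w d ^+ (n %/ d)).
Proof.
move=> n0 h; apply: natdvd_prime_powers => // q pq /dvdnP[m nE].
have q1 := prime_gt1 pq.
have m0 : (0 < m)%N by move: n0; rewrite nE; case: m {nE}.
have mn : (m < n)%N by rewrite nE; nia.
have -> : psi n r = \sum_(1 <= d < n | (d %| m)%N) d%:R * psi q (w d) ^+ (m %/
  d).
  rewrite big_divisors_wide // nE mulnC psiM // ?(ltnW q1) // h // rmorph_sum.
  by apply: eq_bigr => d _; rewrite rmorphM rmorph_nat rmorphXn.
rewrite [X in _ - X](bigID (fun d => d %| m)%N) /= opprD addrA.
apply: natdvdB.
  rewrite [X in _ - X](eq_bigl (fun d => d %| m)%N) => [|d]; last first.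
    by rewrite andbC; case: (boolP (d %| m)%N) => // dm; rewrite nE dvdn_mulr.
  rewrite big_nat_cond [X in _ - X]big_nat_cond -sumrB; apply: natdvd_sum => d.
  case/andP=> /andP[d0 _] /dvdnP[e mE].
  have e0 : (0 < e)%N by move: m0; rewrite mE; case: e {mE}.
  have -> : (n %/ d = q * e)%N by rewrite nE mE mulnAC mulnK // mulnC.
  have -> : (m %/ d = e)%N by rewrite mE mulnK.
  rewrite -mulrBr exprM.
  (* The factor d carries its own power of q; the remaining exponent comes from raising the
     Frobenius congruence for w_d to the power e. *)
  have -> : logn q n = (logn q d + (logn q e).+1)%N.
    rewrite nE mE !lognM ?muln_gt0 ?e0 ?d0 ?(ltnW q1) //.
    by rewrite (logn_prime q pq) eqxx addn1 addnC addnS.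
  rewrite expnD; apply: natdvdM; first exact/natdvd_natr/pfactor_dvdnn.
  by apply: natdvd_subX_logn => //; apply: psi_frobenius.
(* If d divides n but not m = n / q, then q does not divide n / d, so d carries the full power of q
   in n. *)
rewrite big_nat_cond; apply: natdvd_sum => d /andP[/andP[d0 _] /andP[/dvdnP[e
  ne] dm]].
apply/natdvdMr/natdvd_natr; rewrite -(@Gauss_dvdr _ e); last first.
  apply: coprimeXl; rewrite prime_coprime //; apply: contra dm => /dvdnP[e' eE].
  apply/dvdnP; exists e'; apply/eqP; rewrite -(eqn_pmul2r (ltnW q1)) -nE ne eE.
  by rewrite mulnAC.
by rewrite -ne pfactor_dvdnn.
Qed.

(** The coordinates are found one at a time; [witt_congruence] is what allows the division by n that
    yields w_n. *)
Lemma witt_decomposition r N : exists w : nat -> A, forall n, (0 < n)%N -> (n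
  <= N)%N ->
  psi n r = \sum_(1 <= d < n.+1 | (d %| n)%N) d%:R * w d ^+ (n %/ d).
Proof.
elim: N => [|N [w wE]]; first by exists (fun _ => 0) => n n0; rewrite leqNgt n0.
have [|c cE] := @witt_congruence w r N.+1 isT.
  by move=> m m0 mN; apply: wE.
exists (fun d => if (d <= N)%N then w d else c) => n n0.
have low d : (d < N.+1)%N -> (if (d <= N)%N then w d else c) = w d.
  by rewrite ltnS => ->.
rewrite leq_eqVlt => /orP[/eqP nE | nN].
  subst n; rewrite big_mkcond big_nat_recr //= -big_mkcond dvdnn divnn ltnn
    expr1.
  rewrite -cE addrC -[LHS](subrK (\sum_(1 <= d < N.+1 | (d %| N.+1)%N) d%:R * w
    d ^+ (N.+1 %/ d))).
  congr (_ + _); rewrite [LHS]big_nat_cond [RHS]big_nat_cond; apply: eq_bigr =>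
    d.
  by case/andP=> /andP[_ dN] _; rewrite low.
rewrite wE // [LHS]big_nat_cond [RHS]big_nat_cond; apply: eq_bigr => d.
by case/andP=> /andP[_ dN] _; rewrite low // (leq_trans dN).
Qed.

(* The lambda-series is the product of the 1 - w_d (-t)^d.                    *)
Lemma newton_psi_upto r N :
  exists a : nat -> A, a 0%N = 1 /\ newton N a (psi^~ r).
Proof.
have [w wE] := witt_decomposition r N.
pose c d := - (w d * (-1) ^+ d).
exists (fun n => (\prod_(1 <= d < N.+1) (1 + (c d)%:P * 'X^d : {poly A}))`_n);
  split.
  rewrite big_nat coef0_prod big1 // => d /andP[d0 _].
  by case: d d0 => // d _; rewrite coefD coef1 coefCM coefXn mulr0 addr0.
have nw : newton N (fun n => (\prod_(1 <= d < N.+1) (1 + (c d)%:P * 'X^d :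
  {poly A}))`_n)
    (fun n => \sum_(1 <= d < N.+1) if (d %| n)%N then (-1) ^+ n * d%:R * (- c
      d) ^+ (n %/ d) else 0).
  rewrite big_nat; apply: (eq_newton (p := fun n => \sum_(1 <= d < N.+1 | (0 <
    d)%N && (d < N.+1)%N)
     if (d %| n)%N then (-1) ^+ n * d%:R * (- c d) ^+ (n %/ d) else 0) _ _ _)
       => // [k _|].
    by rewrite [RHS]big_nat.
  by apply: newton_poly_prod => d /andP[d0 _] M; apply: newton_binomial.
apply: (eq_newton _ _ nw) => // k kN.
rewrite -big_mkcond wE // big_divisors_wide //; apply: eq_bigr => d /dvdnP[e
  kE].
have d0 : (0 < d)%N by case: d kE => //; rewrite muln0.
rewrite kE mulnK // /c opprK exprMn -exprM mulnC mulrAC mulrCA.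
by move: ((-1) ^+ _) (sqrr_sign A (d * e)) => s s2; ring: s2.
Qed.

(** The truncated solutions agree by uniqueness, so their diagonal solves all degrees. *)
Lemma newton_psi r :
  exists a : nat -> A, a 0%N = 1 /\ forall N, newton N a (psi^~ r).
Proof.
have [a aP] := choice (newton_psi_upto r).
have aE N k : (k <= N)%N -> a N k = a k k.
  move=> kN; by apply: (newton_elementary_uniq tfA (aP N).1 (aP k).1
    (newtonW kN (aP N).2) (aP k).2).
exists (fun n => a n n); split=> [|N]; first exact: (aP 0%N).1.
by apply: (eq_newton _ _ (aP N).2) => // k; exact: aE.
Qed.

(** Each axiom equates two sequences of elementary functions with the same power sums, and these are
    equal in the absence of torsion. *)
Lemma psi_lambda_ring : exists lam : nat -> A -> A,
  lambda_ring lam /\ forall n r, adams lam n.+1 r = psi n.+1 r.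
Proof.
have [lam lamP] : exists lam : nat -> A -> A, forall r,
    lam 0%N r = 1 /\ forall N, newton N (lam^~ r) (psi^~ r).
  by have [a aP] := choice newton_psi; exists (fun n r => a r n).
have lam0 r : lam 0%N r = 1 := (lamP r).1.
have lamN r N : newton N (lam^~ r) (psi^~ r) := (lamP r).2 N.
have lam_uniq r n (b : nat -> A) (q : nat -> A) : b 0%N = 1 -> newton n b q ->
    (forall k, (k < n)%N -> psi k.+1 r = q k.+1) -> lam n r = b n.
  by move=> b0 nb pq; apply: (newton_elementary_uniq tfA (lam0 r) b0 (lamN r n)
    nb).
have lam_psi m k r : lam m (psi k.+1 r) = psi k.+1 (lam m r).
  apply: (lam_uniq _ _ (psi k.+1 \o lam^~ r) (psi k.+1 \o psi^~ r)).
  - by rewrite /= lam0 rmorph1.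
  - exact: newton_rmorph.
  - by move=> j _; rewrite /= -!psiM // mulnC.
exists lam; split; last first.
  move=> n r; apply: (newton_power_sums_uniq (lam0 r)
    (adams_newtonE (N := n.+1) (lam0 r)) (lamN r n.+1)) => //.
split=> //.
- move=> r; have := lamN r 1%N 1%N (leqnn _).
  by rewrite big_ord1 mul1r expr0 mul1r lam0 mul1r psi1.
- move=> n n1; rewrite (lam_uniq 1 n (elemsym (fun _ : 'I_1 => 1)) (fun k =>
    \sum_(i < 1) 1 ^+ k)).
  + by rewrite elemsym_large.
  + exact: elemsym0.
  + exact: newton_elemsym.
  + by move=> k _; rewrite big_ord1 expr1n rmorph1.
- move=> n r s; apply: (lam_uniq _ _ (fun n => \sum_(i < n.+1) lam i r * lam (n
    - i)%N s)
    (fun n => psi n r + psi n s)).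
  + by rewrite big_ord1 !lam0 mulr1.
  + by apply: (@newtonM _ (lam^~ r) (lam^~ s) (psi^~ r) (psi^~ s)) => N; apply:
      lamN.
  + by move=> k _; rewrite rmorphD.
- move=> n r s; have [B [f [c [t [pf c0 nc cE tE]]]]] :=
    lambda_prod_splitting (lam0 r) (lam0 s) (lamN r n) (lamN s n).
  apply: (pure_extension_inj pf); rewrite cE.
  apply: (newton_elementary_uniq (pf.1 tfA) _ c0
    (newton_rmorph f (lamN (r * s) n)) (nc n)) => //.
    by rewrite /= lam0 rmorph1.
  by move=> k kn; rewrite -tE //= rmorphM.
- move=> n m r; have [B [f [c [t [pf c0 nc cE tE]]]]] :=
    lambda_comp_splitting (lam0 r) (lamN r (n * m)%N).
  apply: (pure_extension_inj pf); rewrite cE.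
  apply: (newton_elementary_uniq (pf.1 tfA) _ c0
    (newton_rmorph f (lamN (lam m r) n)) (nc n)) => //.
    by rewrite /= lam0 rmorph1.
  (* As psi_k commutes with lam_m, the power sum psi_k(lam_m r) is lam_m(psi_k r), which is compared
     with the m-th elementary function of the x_i^k. *)
  move=> k /tE[b [b0 nb <-]]; rewrite /= -lam_psi.
  apply: (newton_elementary_uniq (pf.1 tfA) _ b0
    (newton_rmorph f (lamN (psi k.+1 r) m)) nb) => //.
    by rewrite /= lam0 rmorph1.
  by move=> j _; rewrite /= -psiM.
Qed.

End Wilkerson.

Lemma rmorphism_of_morphism (A B : comNzRingType) (f : A -> B) :
  zmod_morphism f -> monoid_morphism f -> exists g : {rmorphism A -> B}, g =1 f.
Proof.
move=> fB fM.
pose fB' := GRing.isZmodMorphism.Build A B f fB.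
pose fM' := GRing.isMonoidMorphism.Build A B f fM.
pose g : {rmorphism A -> B} := HB.pack f fB' fM'.
by exists g.
Qed.

Lemma rmorphism_ext (A B : comNzRingType) (f g : {rmorphism A -> B}) :
  f =1 g -> f = g.
Proof.
case: f => f [[fa] [fm]]; case: g => g [[ga] [gm]] /= /funext fg; subst g.
by have -> : fa = ga := Prop_irrelevance _ _; have -> : fm = gm :=
  Prop_irrelevance _ _.
Qed.

(** Newton's relation places i lam_i(a) in the ideal of a; the saturation hypothesis then removes
    the factor i. *)
Theorem wilkerson (A : comNzRingType) (F : filtration A) (psi : nat -> A -> A) :
  torsion_free A ->
  (forall (k n : nat) a, (0 < k)%N -> F n (k%:R * a) -> F n a) ->
  filtered_psi_structure F psi ->
  exists L : filtered_lambda_structure F,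
    forall p r, prime p -> adams L p r = psi p r.
Proof.
move=> tfA satF [morF frob comm].
have rm p : exists g : {rmorphism A -> A}, prime p -> g =1 psi p.
  case: (boolP (prime p)) => [pp | _]; last by exists idfun.
  by have [fB fM _] := morF p pp; have [g gE] := rmorphism_of_morphism fB fM;
    exists g.
have [Psi PsiE] := choice rm.
have Psi_comm p q r : prime p -> prime q -> Psi p (Psi q r) = Psi q (Psi p r).
  by move=> pp pq; rewrite !PsiE // comm.
have PsiNE p : prime p -> psi_nat Psi p =1 psi p.
  by move=> pp r; rewrite -[p]muln1 (psi_natMp Psi_comm) ?psi_nat1 ?PsiE ?muln1.
have [p r pp|lam [lamP lamE]] := psi_lambda_ring tfA (psi_nat1 Psi) (psi_natM
  Psi_comm).
  by rewrite PsiNE //; apply: frob.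
have psiF n k a : (0 < k)%N -> F n a -> F n (psi_nat Psi k a).
  move=> k0 Fa; move: k k0; apply: mul_prime_ind => [|p k pp k0 IH]; first by
    rewrite psi_nat1.
  by rewrite (psi_natMp Psi_comm) // PsiE //; have [_ _] := morF p pp; apply.
have lamF i n a : (0 < i)%N -> F n a -> F n (lam i a).
  move=> i0 Fa; apply: (satF i) => //.
  rewrite (@adams_newtonE _ lam a i (lambda0 lamP a) i) //.
  apply: (big_ind (F n)); [exact: filt_zero | exact: filt_add |].
  by move=> j _; apply: filt_mul; rewrite lamE; apply: psiF.
exists (FilteredLambda lamP lamF) => p r pp.
by rewrite /= -PsiNE // -(prednK (prime_gt0 pp)) lamE.
Qed.

(** * Composition of power series *)

Lemma torsion_free_fps (R : comNzRingType) : torsion_free R -> torsion_free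
  (fps R).
Proof.
move=> tfR n f n0 fn; apply: fpsP => k.
have -> : coefps (0 : fps R) k = 0 by case: k.
apply: (tfR n _ n0).
have -> : coefps f k *+ n = coefps (f *+ n) k; last by rewrite fn; case: k.
by elim: n {n0 fn} => [|n IH]; [case: k | rewrite !mulrS /= IH].
Qed.

Section Composition.
Variable R : comNzRingType.
Implicit Types (f g h : fps R).

Fact fpsC_zmod_morphism : zmod_morphism (@fpsC R).
Proof. by move=> a b; apply: fpsP => -[|n] //=; rewrite subr0. Qed.
Fact fpsC_monoid_morphism : monoid_morphism (@fpsC R).
Proof.
split=> // a b; apply: fpsP => n /=; rewrite big_ord_recl /= subn0 big1.
  by case: n => [|n]; rewrite ?mulr0 addr0.
by move=> i _; rewrite mul0r.
Qed.
HB.instance Definition _ :=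
  GRing.isZmodMorphism.Build R (fps R) (@fpsC R) fpsC_zmod_morphism.
HB.instance Definition _ :=
  GRing.isMonoidMorphism.Build R (fps R) (@fpsC R) fpsC_monoid_morphism.

Lemma coefps0 n : coefps (0 : fps R) n = 0.
Proof. by case: n. Qed.

Lemma coefps_sum (I : Type) (r : seq I) (P : pred I) (F : I -> fps R) n :
  coefps (\sum_(i <- r | P i) F i) n = \sum_(i <- r | P i) coefps (F i) n.
Proof. by apply: (big_morph (fun f => coefps f n)) => //; apply: coefps0. Qed.

Lemma coefpsD f g n : coefps (f + g) n = coefps f n + coefps g n.
Proof. by []. Qed.

Lemma coefpsB f g n : coefps (f - g) n = coefps f n - coefps g n.
Proof. by []. Qed.

Lemma coefpsM f g n :
  coefps (f * g) n = \sum_(i < n.+1) coefps f i * coefps g (n - i)%N.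
Proof. by []. Qed.

Lemma coefpsCM c f n : coefps (fpsC c * f) n = c * coefps f n.
Proof.
rewrite coefpsM big_ord_recl /= subn0 big1 ?addr0 // => i _.
by rewrite mul0r.
Qed.

Lemma coefps_natM m f n : coefps (m%:R * f) n = m%:R * coefps f n.
Proof. by rewrite -(rmorph_nat (@fpsC R)) coefpsCM. Qed.

Lemma coefpsXM f n : coefps (fpsX R * f) n = if n is m.+1 then coefps f m else
  0.
Proof.
rewrite coefpsM big_ord_recl /= mul0r add0r; case: n => [|n]; first by rewrite
  big_ord0.
rewrite big_ord_recl /= mul1r subn1 big1 ?addr0 // => i _.
by rewrite mul0r.
Qed.

Lemma coefpsXnM k f n :
  coefps (fpsX R ^+ k * f) n = if (n < k)%N then 0 else coefps f (n - k)%N.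
Proof.
elim: k n => [|k IH] n; first by rewrite mul1r subn0.
by rewrite exprS -mulrA coefpsXM; case: n => [|n] //; rewrite IH ltnS subSS.
Qed.

Lemma coefpsXn k n : coefps (fpsX R ^+ k) n = (n == k)%:R.
Proof.
rewrite -[_ ^+ k]mulr1 coefpsXnM; case: ltngtP => // [kn | ->]; last by rewrite
  subnn.
by rewrite -subn_gt0 in kn; case: (n - k)%N kn.
Qed.

Lemma fpsX_dvd k f : (forall j, (j < k)%N -> coefps f j = 0) ->
  f = fpsX R ^+ k * Fps (fun n => coefps f (k + n)).
Proof.
move=> f0; apply: fpsP => n; rewrite coefpsXnM; case: ltnP => [/f0 // | kn].
by rewrite /= subnKC.
Qed.

Lemma xadic_idealP d n f :
  xadic_ideal d n f <-> forall j, (j < (n + d.-1) %/ d)%N -> coefps f j = 0.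
Proof.
by split=> [[g ->] j jk | /fpsX_dvd fE]; [rewrite coefpsXnM jk | eexists;
  exact: fE].
Qed.

Lemma coefps_expr_low g i n : coefps g 0 = 0 -> (n < i)%N -> coefps (g ^+ i) n
  = 0.
Proof.
move=> g0 ni; have -> := @fpsX_dvd 1 g; last by case.
by rewrite expr1 exprMn coefpsXnM ni.
Qed.

(* Meaningful only when g has no constant term.                               *)
Definition compps f g : fps R :=
  Fps (fun n => \sum_(i < n.+1) coefps f i * coefps (g ^+ i) n).

(** Evaluation of a polynomial at g. Up to any given degree [compps] agrees with it on a truncation,
    which makes [compps] multiplicative. *)
Let subst g (P : {poly R}) : fps R := (map_poly (@fpsC R) P).[g].

Let coef_subst g P n : coefps g 0 = 0 ->
  coefps (subst g P) n = \sum_(i < n.+1) P`_i * coefps (g ^+ i) n.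
Proof.
move=> g0; pose N := maxn n.+1 (size P).
have sP : (size (map_poly (@fpsC R) P) <= N)%N.
  by rewrite (leq_trans (size_poly _ _)) ?leq_maxr.
rewrite /subst (horner_coef_wide _ sP) coefps_sum.
rewrite [RHS](big_ord_widen N (fun i => P`_i * coefps (g ^+ i) n)) ?leq_maxl //.
rewrite [RHS]big_mkcond; apply: eq_bigr => i _; rewrite coef_map coefpsCM.
by case: ltnP => // ni; rewrite coefps_expr_low ?mulr0.
Qed.

Let trunc n f : {poly R} := \poly_(i < n.+1) coefps f i.

Let compps_subst f g n k : coefps g 0 = 0 -> (k <= n)%N ->
  coefps (compps f g) k = coefps (subst g (trunc n f)) k.
Proof.
move=> g0 kn; rewrite coef_subst //; apply: eq_bigr => i _.
by rewrite coef_poly (leq_trans (ltn_ord i)).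
Qed.

Fact compps_zmod_morphism g : zmod_morphism (compps^~ g).
Proof.
move=> f f'; apply: fpsP => n; rewrite coefpsB /= -sumrB.
by apply: eq_bigr => i _; rewrite mulrBl.
Qed.

Lemma comppsC c g : compps (fpsC c) g = fpsC c.
Proof.
apply: fpsP => n /=; rewrite big_ord_recl big1 /= => [|i _]; last by rewrite
  mul0r.
by rewrite addr0; case: n => [|n]; rewrite ?mulr1 ?mulr0.
Qed.

Lemma comppsM f f' g : coefps g 0 = 0 ->
  compps (f * f') g = compps f g * compps f' g.
Proof.
move=> g0; apply: fpsP => n.
transitivity (coefps (subst g (trunc n f * trunc n f')) n).
  rewrite coef_subst //; apply: eq_bigr => i _; rewrite coefM coefpsM; congr (_
    * _).
  have ik : (i <= n)%N by rewrite -ltnS.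
  apply: eq_bigr => j _; rewrite !coef_poly !ltnS (leq_trans (leq_subr _ _) ik).
  by rewrite (leq_trans _ ik) // -ltnS.
rewrite /subst rmorphM hornerM !coefpsM; apply: eq_bigr => i _.
by rewrite -!compps_subst ?leq_subr // -ltnS.
Qed.

Lemma comppsX g : coefps g 0 = 0 -> compps (fpsX R) g = g.
Proof.
move=> g0; apply: fpsP => -[|n] /=; first by rewrite big_ord1 mul0r g0.
rewrite big_ord_recl /= mul0r add0r big_ord_recl /= mul1r expr1 big1 ?addr0 //
  => i _.
by rewrite mul0r.
Qed.

Lemma coefps_compps0 f g : coefps f 0 = 0 -> coefps (compps f g) 0 = 0.
Proof. by move=> f0; rewrite /= big_ord1 f0 mul0r. Qed.

Lemma compps_xadic d n f g : coefps g 0 = 0 ->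
  xadic_ideal d n f -> xadic_ideal d n (compps f g).
Proof.
move=> g0 /xadic_idealP f0; apply/xadic_idealP => j jk.
rewrite /= big1 // => i _; rewrite f0 ?mul0r // (leq_ltn_trans _ jk) // -ltnS.
exact: ltn_ord.
Qed.

Lemma compps_filtered d g : coefps g 0 = 0 ->
  filtered_morphism (xadic R d) (xadic R d) (compps^~ g).
Proof.
move=> g0; split; first exact: compps_zmod_morphism.
  by split=> [|f f']; [apply: (comppsC 1) | apply: comppsM].
by move=> n f; apply: compps_xadic.
Qed.

(* Modulo the n-th power of the variable, f is a polynomial.                  *)
Lemma filtered_morphism_compps (phi : fps R -> fps R) :
  zmod_morphism phi -> monoid_morphism phi ->
  (forall c, phi (fpsC c) = fpsC c) -> coefps (phi (fpsX R)) 0 = 0 ->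
  forall f, phi f = compps f (phi (fpsX R)).
Proof.
move=> phiB phiM phiC X0 f; have [phi' phiE] := rmorphism_of_morphism phiB phiM.
apply: fpsP => n.
have fE : f - subst (fpsX R) (trunc n f) = fpsX R ^+ n.+1 *
    Fps (fun k => coefps (f - subst (fpsX R) (trunc n f)) (n.+1 + k)).
  apply: fpsX_dvd => j jn; rewrite coefpsB coef_subst //.
  rewrite (bigD1 ord_max) //= big1 => [|i ij].
    by rewrite coefpsXn eqxx mulr1 coef_poly jn addr0 subrr.
  rewrite coefpsXn eq_sym (_ : (i == j :> nat) = false) ?mulr0 //.
  by apply: contraNF ij => /eqP e; apply/eqP/val_inj.
have phi_subst P : phi (subst (fpsX R) P) = subst (phi (fpsX R)) P.
  rewrite -!phiE /subst -horner_map -map_poly_comp; congr (_.[_]).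
  by apply: eq_map_poly => c /=; rewrite phiE phiC.
rewrite (@compps_subst _ _ n) // -phi_subst; apply/eqP; rewrite -subr_eq0
  -coefpsB.
rewrite -phiB fE -phiE rmorphM rmorphXn phiE (@fpsX_dvd 1 (phi (fpsX R))).
  by rewrite exprMn expr1 -mulrA coefpsXnM ltnSn.
by case.
Qed.

End Composition.

(** For fixed g and h the left side is a ring morphism in f fixing constants, hence determined by
    its value at x. *)
Lemma comppsA (R : comNzRingType) (f g h : fps R) : coefps g 0 = 0 -> coefps h
  0 = 0 ->
  compps (compps f g) h = compps f (compps g h).
Proof.
move=> g0 h0.
rewrite (@filtered_morphism_compps R (fun f => compps (compps f g) h)).
- by rewrite comppsX.
- by move=> a b; rewrite !compps_zmod_morphism.
- by split=> [|a b]; rewrite ?comppsM // !comppsC.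
- by move=> c; rewrite !comppsC.
- by rewrite comppsX // coefps_compps0.
Qed.

Section MapSeries.
Variables (R S : comNzRingType) (f : {rmorphism R -> S}).

Lemma map_fpsM (a b : fps R) : map_fps f (a * b) = map_fps f a * map_fps f b.
Proof.
by apply: fpsP => n /=; rewrite rmorph_sum; apply: eq_bigr => i _; rewrite
  rmorphM.
Qed.

Lemma map_fpsXn (a : fps R) n : map_fps f (a ^+ n) = map_fps f a ^+ n.
Proof.
elim: n => [|n IH]; last by rewrite !exprS map_fpsM IH.
by apply: fpsP => -[|n] /=; rewrite ?rmorph1 ?rmorph0.
Qed.

Lemma map_fps_compps (a b : fps R) :
  map_fps f (compps a b) = compps (map_fps f a) (map_fps f b).
Proof.
apply: fpsP => n /=; rewrite rmorph_sum; apply: eq_bigr => i _.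
by rewrite rmorphM -map_fpsXn.
Qed.

End MapSeries.

Lemma natdvd_fpsP (R : comNzRingType) m (f : fps R) :
  natdvd m f <-> forall n, natdvd m (coefps f n).
Proof.
split=> [[g ->] n | /choice[g gE]].
  by rewrite coefps_natM; exists (coefps g n).
by exists (Fps g); apply: fpsP => n; rewrite coefps_natM gE.
Qed.

(** Modulo p, f^p is the sum of the f_i^p x^(ip); here f_i^p = f_i by hypothesis and x^(ip) = g^i.
    The truncation [T] reduces each coefficient to a finite sum. *)
Lemma compps_frobenius (R : comNzRingType) p (f g : fps R) : prime p ->
  (forall b : R, natdvd p (b ^+ p - b)) ->
  coefps g 0 = 0 -> natdvd p (g - fpsX R ^+ p) ->
  natdvd p (compps f g - f ^+ p).
Proof.
move=> pp fermat g0 gX; apply/natdvd_fpsP => n.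
pose T := \sum_(i < n.+1) fpsC (coefps f i) * fpsX R ^+ i.
have fT : coefps (f ^+ p) n = coefps (T ^+ p) n.
  apply/eqP; rewrite -subr_eq0 -coefpsB subrXX (@fpsX_dvd _ n.+1 (f - T)).
    by rewrite -mulrA coefpsXnM ltnSn.
  move=> j jn; rewrite coefpsB coefps_sum (bigD1 (Ordinal jn)) // big1 => [|i
    ij].
    by rewrite [X in _ - X]addr0 coefpsCM coefpsXn eqxx mulr1 subrr.
  rewrite coefpsCM coefpsXn eq_sym (_ : (i == j :> nat) = false) ?mulr0 //.
  by apply: contraNF ij => /eqP e; apply/eqP/val_inj.
have [c cE] := prime_dvd_expr_sum_sub (index_enum 'I_n.+1)
  (fun i => fpsC (coefps f i) * fpsX R ^+ i) pp.
rewrite coefpsB fT cE coefpsD coefps_sum opprD addrA.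
apply: natdvdB; last by rewrite coefps_natM; exists (coefps c n).
rewrite -sumrB; apply: natdvd_sum => i _.
rewrite exprMn -rmorphXn coefpsCM -exprM mulnC exprM.
set x := coefps f i; set u := coefps _ n; set v := coefps _ n.
have -> : x * u - x ^+ p * v = x * (u - v) - (x ^+ p - x) * v by ring.
apply: natdvdB; last exact/natdvdMr/fermat.
apply: natdvdMl; rewrite -coefpsB; have /natdvd_fpsP := natdvd_subX i gX; exact.
Qed.

Lemma compps_psi_structure (B : comNzRingType) d (G : nat -> fps B) :
  (forall p (b : B), prime p -> natdvd p (b ^+ p - b)) ->
  (forall p, prime p -> coefps (G p) 0 = 0) ->
  (forall p, prime p -> natdvd p (G p - fpsX B ^+ p)) ->
  (forall p q, prime p -> prime q -> compps (G p) (G q) = compps (G q) (G p)) ->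
  filtered_psi_structure (xadic B d) (fun p F => compps F (G p)).
Proof.
move=> fermat G0 GX GC; split=> [p pp | p pp F | p q pp pq F].
- by apply: compps_filtered; apply: G0.
- exact: compps_frobenius pp (fun b => fermat p b pp) (G0 p pp) (GX p pp).
- by rewrite (comppsA _ (G0 q pq) (G0 p pp)) (comppsA _ (G0 p pp) (G0 q pq)) GC.
Qed.

(** * Binomial domains *)

Lemma coprime_part_split m v : (0 < m)%N ->
  exists a b N, [/\ m = (a * b)%N, (a %| v ^ N)%N & coprime b v].
Proof.
elim/ltn_ind: m => m IH m0; case: (boolP (coprime m v)) => [c | nc].
  by exists 1%N, m, 0%N; rewrite mul1n dvd1n.
have /dvdnP[k mE] := dvdn_gcdl m v.
have g0 : (0 < gcdn m v)%N by rewrite gcdn_gt0 m0.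
have k0 : (0 < k)%N by case: k mE m0 => // ->.
have [|//|a [b [N [kE av cb]]]] := IH k.
  by rewrite [m]mE; move: nc g0; rewrite /coprime; case: (gcdn m v) => [|[|g]]
    //; nia.
exists (gcdn m v * a)%N, b, N.+1; split=> //; first by rewrite [LHS]mE kE mulnC
  mulnA.
by rewrite expnS dvdn_mul // dvdn_gcdr.
Qed.

Lemma natdvd_sub_prod (A : comNzRingType) m n (f g : nat -> A) :
  (forall i, natdvd m (f i - g i)) ->
  natdvd m (\prod_(i < n) f i - \prod_(i < n) g i).
Proof.
move=> d; elim: n => [|n IH]; first by rewrite !big_ord0 subrr; apply: natdvd0.
rewrite !big_ord_recr /=; set x := \prod_(i < n) f i; set y := \prod_(i < n) g
  i.
have -> : x * f n - y * g n = (x - y) * f n + y * (f n - g n) by ring.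
by apply: natdvdD; [apply: natdvdMr | apply: natdvdMl].
Qed.

(** Over F_p, X^p - X is the product of the X - i, and the value of that product at b is p! times a
    binomial coefficient lying in B. *)
Lemma binomial_domain_fermat (B : comNzRingType) p (b : B) :
  binomial_domain B -> prime p -> natdvd p (b ^+ p - b).
Proof.
move=> [_ binB] pp.
pose Q : {poly int} := 'X^p - 'X - \prod_(i < p) ('X - (i%:R)%:P).
have pQ k : (p %| Q`_k)%Z.
  rewrite (@dvdz_pcharf 'F_p) ?pchar_Fp // -coef_map /=.
  suff -> : map_poly intr Q = 0 :> {poly 'F_p} by rewrite coef0.
  rewrite /Q !rmorphB /= map_polyXn map_polyX rmorph_prod.
  have -> : 'X^p - 'X = \prod_(x : 'F_p) ('X - x%:P).
    by rewrite -finField_genPoly card_Fp.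
  apply/eqP; rewrite subr_eq0; apply/eqP.
  rewrite -[RHS](big_mkord xpredT (fun i => map_poly intr ('X - (i%:R)%:P))).
  rewrite -[X in index_iota 0 X](Fp_cast pp) big_mkord; apply: eq_bigr => i _.
  by rewrite rmorphB /= map_polyX map_polyC /= rmorph_nat natr_Zp.
have [c cE] := binB b p (prime_gt0 pp).
have -> : b ^+ p - b = (map_poly intr Q).[b] + c *+ p`!.
  rewrite cE /Q !rmorphB /= map_polyXn map_polyX rmorph_prod !hornerE
    horner_prod.
  rewrite [X in _ = _ - X + _](eq_bigr (fun i : 'I_p => b - i%:R)) ?subrK // =>
    i _.
  by rewrite rmorphB /= map_polyX map_polyC /= rmorph_nat !hornerE.
apply: natdvdD; last first.
  rewrite -mulr_natl; apply/natdvdMr/natdvd_natr.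
  by rewrite -(prednK (prime_gt0 pp)) factS dvdn_mulr.
rewrite horner_coef; apply: natdvd_sum => i _; apply: natdvdMr; rewrite
  coef_map.
by have /dvdzP[k ->] := pQ i; rewrite /= intrM mulrC; exists k%:~R.
Qed.

Section SubringOfRat.
Variables (R : comNzRingType) (iota : {rmorphism R -> rat}).
Hypothesis iota_inj : injective iota.

Lemma rat_subring_torsion_free : torsion_free R.
Proof.
move=> n a n0 /(congr1 iota) /eqP; rewrite raddfMn rmorph0 -mulr_natl mulf_eq0.
by rewrite Num.Theory.pnatr_eq0 eqn0Ngt n0 /= => /eqP a0; apply: iota_inj;
  rewrite a0 rmorph0.
Qed.

(* If b = u / v in lowest terms then 1 / v lies in R by Bezout. In n!, the    *)
(* part supported on the primes of v is invertible in R, and modulo the part  *)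
(* prime to v the element b is congruent to an integer.                       *)
Lemma rat_subring_binomial (b : R) n :
  exists c : R, c *+ n`! = \prod_(i < n) (b - i%:R).
Proof.
set u := numq (iota b); pose v := `|denq (iota b)|%N.
have vE : denq (iota b) = v%:Z by rewrite /v gez0_abs // denq_ge0.
have buv : b * v%:R = u%:~R.
  apply: iota_inj; rewrite rmorphM rmorph_nat rmorph_int.
  by rewrite -[v%:R]/((v%:Z)%:~R) -vE -{1}[iota b]divq_num_den divfK //
    intr_eq0 denq_neq0.
have [t vt] : exists t : R, v%:R * t = 1.
  have [x [y xy]] := Bezoutz u v%:Z; exists (x%:~R * b + y%:~R).
  have -> : v%:R * (x%:~R * b + y%:~R) = x%:~R * (b * v%:R) + y%:~R * v%:R by
    ring.
  rewrite buv -[v%:R]/((v%:Z)%:~R) -!rmorphM -rmorphD xy /gcdz.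
  by rewrite -vE (eqP (coprime_num_den _)).
have bE : b = u%:~R * t by rewrite -buv -mulrA vt mulr1.
have [m1 [m2 [N [nE m1v cm2]]]] := coprime_part_split v (fact_gt0 n).
have /andP[m10 m20] : (0 < m1)%N && (0 < m2)%N by rewrite -muln_gt0 -nE
  fact_gt0.
have [s m1s] : exists s : R, m1%:R * s = 1.
  have /dvdnP[k kE] := m1v; exists (k%:R * t ^+ N).
  by rewrite mulrA -natrM mulnC -kE natrX -exprMn vt expr1n.
have [c bc] : exists c : nat, natdvd m2 (b - c%:R).
  have [k v' e _] := egcdnP v m20; rewrite (eqP cm2) in e.
  (* Bezout reads k m2 = v' v + 1, so 1 / v = - v' mod m2 and b = z mod m2; the residue of z is a
     natural number. *)
  pose z := (- u * v'%:Z)%R; have m2z : m2%:Z != 0 by rewrite -lt0n.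
  exists `|(z %% m2%:Z)%Z|%N.
  have tE : t + v'%:R = m2%:R * (k%:R * t).
    by rewrite mulrA -natrM [(m2 * k)%N]mulnC e natrD natrM mulrDl mul1r -mulrA
      vt mulr1 addrC.
  have -> : (`|(z %% m2%:Z)%Z|%N)%:R = z%:~R - m2%:R * (z %/ m2%:Z)%Z%:~R :> R.
    rewrite -[_%:R]/((`|(z %% m2%:Z)%Z|%N%:Z)%:~R) gez0_abs ?modz_ge0 //.
    have /(congr1 (fun x : int => x%:~R : R)) := divz_eq z m2%:Z.
    by rewrite intrD intrM -[m2%:Z%:~R]/(m2%:R) => ->; ring.
  have -> : b = u%:~R * (t + v'%:R) + z%:~R by rewrite bE /z intrM mulrNz
    -[v'%:Z%:~R]/(v'%:R); ring.
  exists (u%:~R * (k%:R * t) + (z %/ m2%:Z)%Z%:~R); rewrite tE; ring.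
have [w wE] : natdvd m2 (\prod_(i < n) (b - i%:R)).
  rewrite -[X in natdvd _ X](subrK (\prod_(i < n) (c%:R - i%:R))).
  apply: natdvdD.
    apply: (@natdvd_sub_prod _ _ _ (fun i => b - i%:R) (fun i => c%:R - i%:R))
      => i.
    by rewrite opprB addrA subrK.
  (* A falling factorial of a natural number is divisible by n!, hence by [m2]; for c < n both sides
     vanish. *)
  have -> : \prod_(i < n) (c%:R - i%:R) = (c ^_ n)%:R :> R.
    rewrite ffact_prod natr_prod; case: (leqP n c) => [nc | cn].
      by apply: eq_bigr => i _; rewrite natrB // (leq_trans _ nc) // ltnW.
    rewrite (bigD1 (Ordinal cn)) //= subrr mul0r [RHS](bigD1 (Ordinal cn)) //=.
    by rewrite subnn mul0r.
  by apply: natdvd_natr; rewrite -bin_ffact nE dvdn_mull // dvdn_mull.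
exists (s * w); rewrite wE -(mulr_natl (s * w)) nE natrM.
by transitivity (m1%:R * s * (m2%:R * w)); [ring | rewrite m1s mul1r].
Qed.

Lemma rat_subring_binomial_domain : binomial_domain R.
Proof. by split=> [n b n0|b n _]; [apply: rat_subring_torsion_free | apply:
  rat_subring_binomial]. Qed.

End SubringOfRat.

(** * The universal ring *)

Definition commuting_family (G : nat -> fps rat) : Prop :=
  (forall p, prime p -> coefps (G p) 0 = 0) /\
  (forall p q, prime p -> prime q -> compps (G p) (G q) = compps (G q) (G p)).

Definition rat_point := {G : nat -> fps rat | commuting_family G}.

(* The coordinate b_(p,i) of the point psi^p(x) = x^p + p sum_i b_(p,i) x^i,  *)
(* made to vanish when p is not prime.                                        *)
Definition coordinate (p i : nat) (s : rat_point) : rat :=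
  if prime p then (coefps (sval s p) i - (i == p)%:R) / p%:R else 0.

(** As the values are rational, binomial coefficients are genuine quotients, and every relation that
    holds at all points holds in the ring. *)
Inductive universal_fun : (rat_point -> rat) -> Prop :=
| UniversalCoordinate p i : universal_fun (coordinate p i)
| UniversalOne : universal_fun (fun _ => 1)
| UniversalSub g h : universal_fun g -> universal_fun h ->
    universal_fun (fun s => g s - h s)
| UniversalMul g h : universal_fun g -> universal_fun h ->
    universal_fun (fun s => g s * h s)
| UniversalBinomial g n : universal_fun g ->
    universal_fun (fun s => (\prod_(i < n) (g s - i%:R)) / n`!%:R).

Record universal := Universal {
  universal_val :> rat_point -> rat;
  universalP : universal_fun universal_val
}.

HB.instance Definition _ := gen_eqMixin universal.
HB.instance Definition _ := gen_choiceMixin universal.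

Lemma universal_ext (u v : universal) : (forall s, u s = v s) -> u = v.
Proof.
case: u v => [u uP] [v vP] /= /funext uv; subst v.
by congr Universal; apply: Prop_irrelevance.
Qed.

Lemma universal_fun0 : universal_fun (fun _ => 0).
Proof.
rewrite (_ : (fun _ => 0) = (fun s : rat_point => 1 - 1)); last by rewrite
  subrr.
by apply: UniversalSub; apply: UniversalOne.
Qed.

Lemma universal_funN g : universal_fun g -> universal_fun (fun s => - g s).
Proof.
move=> Ug; rewrite (_ : (fun s => - g s) = (fun s => 0 - g s)).
  by apply: UniversalSub => //; apply: universal_fun0.
by apply/funext => s; rewrite sub0r.
Qed.

Lemma universal_funD g h : universal_fun g -> universal_fun h ->
  universal_fun (fun s => g s + h s).
Proof.
move=> Ug Uh; rewrite (_ : (fun s => g s + h s) = (fun s => g s - - h s)).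
  by apply: UniversalSub => //; apply: universal_funN.
by apply/funext => s; rewrite opprK.
Qed.

Section UniversalRing.
Implicit Types u v w : universal.

Let zero := Universal universal_fun0.
Let one := Universal UniversalOne.
Let add u v := Universal (universal_funD (universalP u) (universalP v)).
Let opp u := Universal (universal_funN (universalP u)).
Let mul u v := Universal (UniversalMul (universalP u) (universalP v)).

Let addA : associative add.
Proof. by move=> u v w; apply: universal_ext => s /=; rewrite addrA. Qed.
Let addC : commutative add.
Proof. by move=> u v; apply: universal_ext => s /=; rewrite addrC. Qed.
Let add0 : left_id zero add.
Proof. by move=> u; apply: universal_ext => s /=; rewrite add0r. Qed.
Let addN : left_inverse zero opp add.
Proof. by move=> u; apply: universal_ext => s /=; rewrite addNr. Qed.

HB.instance Definition _ := GRing.isZmodule.Build universal addA addC add0 addN.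

Let mulA : associative mul.
Proof. by move=> u v w; apply: universal_ext => s /=; rewrite mulrA. Qed.
Let mulC : commutative mul.
Proof. by move=> u v; apply: universal_ext => s /=; rewrite mulrC. Qed.
Let mul1 : left_id one mul.
Proof. by move=> u; apply: universal_ext => s /=; rewrite mul1r. Qed.
Let mulDl : left_distributive mul add.
Proof. by move=> u v w; apply: universal_ext => s /=; rewrite mulrDl. Qed.

(* The family x |-> x^p is a point, so the ring is not trivial.               *)
Let one_neq0 : one != zero.
Proof.
have cX : commuting_family (fun p => fpsX rat ^+ p).
  have X0 p : prime p -> coefps (fpsX rat ^+ p) 0 = 0 by case: p => // p _;
    rewrite coefpsXn.
  have compX p q : prime q -> compps (fpsX rat ^+ p) (fpsX rat ^+ q) = fpsX rat
    ^+ (p * q).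
    move=> pq; elim: p => [|p IH].
      by rewrite !expr0 -[1](rmorph1 (@fpsC rat)) comppsC.
    by rewrite exprS comppsM ?comppsX ?IH ?X0 // mulSn exprD.
  by split=> // p q pp pq; rewrite !compX // mulnC.
apply/eqP => /(congr1 (fun u : universal => u (exist _ _ cX))) /=.
by apply/eqP; rewrite oner_eq0.
Qed.

HB.instance Definition _ := GRing.Zmodule_isComNzRing.Build universal
  mulA mulC mul1 mulDl one_neq0.

End UniversalRing.

Definition universal_eval (s : rat_point) (u : universal) : rat := u s.

Fact universal_eval_zmod s : zmod_morphism (universal_eval s).
Proof. by []. Qed.
Fact universal_eval_monoid s : monoid_morphism (universal_eval s).
Proof. by []. Qed.
HB.instance Definition _ s :=
  GRing.isZmodMorphism.Build universal rat (universal_eval s)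
    (universal_eval_zmod s).
HB.instance Definition _ s :=
  GRing.isMonoidMorphism.Build universal rat (universal_eval s)
    (universal_eval_monoid s).

Lemma universal_eval_inj (u v : universal) :
  (forall s, universal_eval s u = universal_eval s v) -> u = v.
Proof. exact: universal_ext. Qed.

Lemma universal_torsion_free : torsion_free universal.
Proof.
move=> n u n0 un; apply: universal_eval_inj => s.
have : universal_eval s (n%:R * u) = 0 by rewrite mulr_natl un rmorph0.
rewrite rmorphM rmorph_nat rmorph0 => /eqP; rewrite mulf_eq0
  Num.Theory.pnatr_eq0.
by rewrite eqn0Ngt n0 => /eqP.
Qed.

Lemma fact_neq0 n : n`!%:R != 0 :> rat.
Proof. by rewrite Num.Theory.pnatr_eq0 -lt0n fact_gt0. Qed.

Lemma universal_binomialE (u c : universal) n :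
  (forall s, c s = (\prod_(i < n) (u s - i%:R)) / n`!%:R) ->
  n`!%:R * c = \prod_(i < n) (u - i%:R).
Proof.
move=> cE; apply: universal_eval_inj => s.
have -> : universal_eval s (n`!%:R * c) = n`!%:R * c s by rewrite rmorphM
  rmorph_nat.
rewrite rmorph_prod cE mulrC divfK ?fact_neq0 //.
by apply: eq_bigr => i _; rewrite rmorphB rmorph_nat.
Qed.

Lemma universal_binomial_domain : binomial_domain universal.
Proof.
split=> [n u n0|u n _]; first exact: universal_torsion_free.
exists (Universal (UniversalBinomial n (universalP u))).
by rewrite -[LHS]mulr_natl; apply: universal_binomialE.
Qed.

Definition universal_coordinate p i : universal := Universal
  (UniversalCoordinate p i).

Definition universal_series (p : nat) : fps universal :=
  Fps (fun i => (i == p)%:R + p%:R * universal_coordinate p i).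

Lemma prime_natr_neq0 p : prime p -> p%:R != 0 :> rat.
Proof. by move=> pp; rewrite Num.Theory.pnatr_eq0 -lt0n prime_gt0. Qed.

Lemma universal_series_eval s p : prime p ->
  map_fps (universal_eval s) (universal_series p) = sval s p.
Proof.
move=> pp; apply: fpsP => i.
rewrite -[LHS]/(universal_eval s ((i == p)%:R + p%:R * universal_coordinate p
  i)).
rewrite rmorphD rmorphM !rmorph_nat.
rewrite -[X in _ * X]/(coordinate p i s) /coordinate pp.
by rewrite mulrC divfK ?prime_natr_neq0 // addrC subrK.
Qed.

Lemma universal_fps_inj (F G : fps universal) :
  (forall s, map_fps (universal_eval s) F = map_fps (universal_eval s) G) -> F
    = G.
Proof.
move=> FG; apply: fpsP => n; apply: universal_eval_inj => s.
exact: (congr1 (fun f => coefps f n) (FG s)).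
Qed.

Lemma universal_series0 p : prime p -> coefps (universal_series p) 0 = 0.
Proof.
move=> pp; apply: universal_eval_inj => s; rewrite rmorph0.
transitivity (coefps (map_fps (universal_eval s) (universal_series p)) 0) => //.
by rewrite universal_series_eval //; apply: (svalP s).1.
Qed.

Lemma universal_series_comm p q : prime p -> prime q ->
  compps (universal_series p) (universal_series q) =
  compps (universal_series q) (universal_series p).
Proof.
move=> pp pq; apply: universal_fps_inj => s.
by rewrite !map_fps_compps !universal_series_eval //; apply: (svalP s).2.
Qed.

Lemma universal_series_mod p :
  natdvd p (universal_series p - fpsX universal ^+ p).
Proof.
apply/natdvd_fpsP => n; rewrite coefpsB coefpsXn /=.
by exists (universal_coordinate p n); rewrite addrC addKr.
Qed.

(** Coordinates are recovered by cancelling p and binomial coefficients by cancelling n!, both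
    legitimate in a torsion-free target. *)
Lemma universal_hom_ext (R : comNzRingType) (f g : {rmorphism universal -> R}) :
  torsion_free R ->
  (forall p, prime p -> map_fps f (universal_series p) = map_fps g
    (universal_series p)) ->
  f = g.
Proof.
move=> tfR fg.
have coordE p i : f (universal_coordinate p i) = g (universal_coordinate p i).
  case: (boolP (prime p)) => [pp | /negbTE np].
    have := congr1 (fun F => coefps F i) (fg p pp) => /=.
    rewrite !rmorphD !rmorphM !rmorph_nat => /addrI.
    exact: torsion_free_mulI (prime_gt0 pp) _ _.
  have -> : universal_coordinate p i = 0.
    by apply: universal_ext => s; rewrite /= /coordinate np.
  by rewrite !rmorph0.
(* Quantifying over every [U] with the values of u keeps the induction independent of membership
   proofs. *)
have fgE u : universal_fun u -> forall U : universal, (forall s, U s = u s) ->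
  f U = g U.
  elim=> {u} [p i | | u v uP IHu vP IHv | u v uP IHu vP IHv | u n uP IHu] U UE.
  - by have -> : U = universal_coordinate p i by apply: universal_ext.
  - by have -> : U = 1; [apply: universal_ext | rewrite !rmorph1].
  - have -> : U = Universal uP - Universal vP by apply: universal_ext.
    by rewrite !rmorphB (IHu (Universal uP)) ?(IHv (Universal vP)).
  - have -> : U = Universal uP * Universal vP by apply: universal_ext.
    by rewrite !rmorphM (IHu (Universal uP)) ?(IHv (Universal vP)).
  - apply: (torsion_free_mulI tfR (fact_gt0 n)) => /=.
    have UnE := @universal_binomialE (Universal uP) U n UE.
    rewrite -[n`!%:R in LHS](rmorph_nat f) -[n`!%:R in RHS](rmorph_nat g)
      -!rmorphM UnE !rmorph_prod.
    by apply: eq_bigr => i _; rewrite !rmorphB !rmorph_nat (IHu (Universal uP)).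
by apply: rmorphism_ext => U; apply: (fgE U (universalP U)).
Qed.

(** The family is a rational point, and evaluation there lands in R: on coordinates because G_p =
    x^p mod p, on binomial coefficients by [rat_subring_binomial]. *)
Lemma universal_hom_exists (R : comNzRingType) (iota : {rmorphism R -> rat})
    (G : nat -> fps R) : injective iota ->
  (forall p, prime p -> coefps (G p) 0 = 0) ->
  (forall p, prime p -> natdvd p (G p - fpsX R ^+ p)) ->
  (forall p q, prime p -> prime q -> compps (G p) (G q) = compps (G q) (G p)) ->
  exists f : {rmorphism universal -> R},
    forall p, prime p -> map_fps f (universal_series p) = G p.
Proof.
move=> iota_inj G0 GX GC.
have cG : commuting_family (fun p => map_fps iota (G p)).
  split=> [p pp | p q pp pq]; first by rewrite /= G0 // rmorph0.
  by rewrite -!map_fps_compps GC.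
pose s : rat_point := exist _ _ cG.
have im u : universal_fun u -> exists r, iota r = u s.
  elim=> {u} [p i | | u v _ [a aE] _ [b bE] | u v _ [a aE] _ [b bE] | u n _ [a
    aE]].
  - rewrite /coordinate; case: ifP => [pp | _]; last by exists 0; rewrite
      rmorph0.
    have /natdvd_fpsP/(_ i)[b bE] := GX p pp; exists b.
    apply: (mulfI (prime_natr_neq0 pp)); rewrite mulrC [RHS]mulrC divfK
      ?prime_natr_neq0 //.
    rewrite -(rmorph_nat iota p) -rmorphM mulrC -bE coefpsB coefpsXn rmorphB /=.
    by rewrite rmorph_nat.
  - by exists 1; rewrite rmorph1.
  - by exists (a - b); rewrite rmorphB aE bE.
  - by exists (a * b); rewrite rmorphM aE bE.
  - have [c cE] := rat_subring_binomial iota_inj a n; exists c.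
    apply: (mulfI (fact_neq0 n)); rewrite [RHS]mulrC divfK ?fact_neq0 //.
    rewrite -(rmorph_nat iota n`!) -rmorphM mulr_natl cE rmorph_prod.
    by apply: eq_bigr => i _; rewrite rmorphB rmorph_nat aE.
have [f fE] := choice (fun U : universal => im U (universalP U)).
have [g gE] : exists g : {rmorphism universal -> R}, g =1 f.
  apply: rmorphism_of_morphism => [U V|]; first by apply: iota_inj; rewrite
    rmorphB !fE.
  by split=> [|U V]; apply: iota_inj; rewrite ?rmorph1 ?rmorphM !fE.
exists g => p pp; apply: fpsP => i; apply: iota_inj; rewrite [coefps _ i]/= gE
  fE.
transitivity (coefps (map_fps (universal_eval s) (universal_series p)) i) => //.
by rewrite universal_series_eval.
Qed.


(** Ring morphisms fix integers, and some positive multiple of c is an integer; absence of torsion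
    does the rest. *)
Lemma rat_subring_endo_id (R : comNzRingType) (iota : {rmorphism R -> rat})
    (phi : {rmorphism fps R -> fps R}) (c : R) :
  injective iota -> phi (fpsC c) = fpsC c.
Proof.
move=> iota_inj; pose v := `|denq (iota c)|%N.
have v0 : (0 < v)%N by rewrite absz_gt0 denq_neq0.
have cv : v%:R * c = (numq (iota c))%:~R.
  apply: iota_inj; rewrite rmorphM rmorph_nat rmorph_int.
  have -> : v%:R = (denq (iota c))%:~R :> rat.
    by rewrite -[v%:R]/((v%:Z)%:~R) gez0_abs // denq_ge0.
  by rewrite -{2}[iota c]divq_num_den mulrC divfK // intr_eq0 denq_neq0.
apply: (torsion_free_mulI (torsion_free_fps (rat_subring_torsion_free
  iota_inj)) v0) => /=.
rewrite -[v%:R in LHS](rmorph_nat phi) -rmorphM -(rmorph_nat (@fpsC R))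
  -rmorphM cv.
by rewrite !rmorph_int.
Qed.

(** * The bijection with filtered lambda-ring structures *)

Lemma filtered_lambda_structure_inj (A : comNzRingType) (F : filtration A)
    (L M : filtered_lambda_structure F) : lambda_op L = lambda_op M -> L = M.
Proof.
case: L M => [l lP lF] [m mP mF] /= e; subst m.
by congr FilteredLambda; apply: Prop_irrelevance.
Qed.

(* A ring R between the integers and the rationals is a ring with an injective *)
(* morphism iota to rat; it contains the integers as it contains 1. The        *)
(* natural map Psi is the only map satisfying the push-forward condition.      *)
Theorem theorem3p3p1 (d : nat) (hd : (0 < d)%N) :
  exists (U : comNzRingType) (psi : nat -> fps U -> fps U),
    [/\ binomial_domain U,
        filtered_psi_structure (xadic U d) psi,
        forall p, prime p -> forall u : U, psi p (fpsC u) = fpsC u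
      & forall (R : comNzRingType) (iota : {rmorphism R -> rat}),
          injective iota ->
          exists2 Psi : {rmorphism U -> R} ->
                        filtered_lambda_structure (xadic R d),
            unique
              (fun Psi0 : {rmorphism U -> R} ->
                          filtered_lambda_structure (xadic R d) =>
                 forall (f : {rmorphism U -> R}) (p : nat), prime p ->
                   is_pushforward d f (psi p) (adams (Psi0 f) p))
              Psi
            & bijective Psi].
Proof.
have fermatU p (u : universal) := binomial_domain_fermat (p := p) u
  universal_binomial_domain.
exists universal, (fun p F => compps F (universal_series p)); split.
- exact: universal_binomial_domain.
- apply: compps_psi_structure => [p u pp | p pp | p pp | p q pp pq].
  + exact: fermatU.
  + exact: universal_series0.
  + exact: universal_series_mod.
  + exact: universal_series_comm.
- by move=> p pp u; apply: comppsC.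
move=> R iota iota_inj.
have tfR := rat_subring_torsion_free iota_inj; have tfRx := torsion_free_fps
  tfR.
have fermatR p (b : R) := binomial_domain_fermat (p := p) b
  (rat_subring_binomial_domain iota_inj).
have satF k n (a : fps R) : (0 < k)%N -> xadic R d n (k%:R * a) -> xadic R d n
  a.
  move=> k0 /xadic_idealP ka; apply/xadic_idealP => j jn.
  by apply: (torsion_free_mulI tfR k0); rewrite /= -coefps_natM ka // mulr0.
have adamsE (L : filtered_lambda_structure (xadic R d)) p : prime p ->
    [/\ filtered_morphism (xadic R d) (xadic R d) (adams L p),
        forall c, adams L p (fpsC c) = fpsC c,
        coefps (adams L p (fpsX R)) 0 = 0,
        forall F, adams L p F = compps F (adams L p (fpsX R))
      & natdvd p (adams L p (fpsX R) - fpsX R ^+ p)].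
  move=> pp; have p0 := prime_gt0 pp; have LP := lambda_opP L.
  have fm : filtered_morphism (xadic R d) (xadic R d) (adams L p).
    rewrite -(prednK p0); split=> [a b||n a Fa]; first exact: (adamsB LP).
      by split=> [|a b]; [apply: (adams1 LP) | apply: (adamsM tfRx LP)].
    exact: adams_filt.
  have [fB fM fF] := fm; have [phi phiE] := rmorphism_of_morphism fB fM.
  have fC c : adams L p (fpsC c) = fpsC c.
    by rewrite -phiE; apply: rat_subring_endo_id iota_inj.
  (* For positive [d] the ideal of index 1 is already generated by x, so a filtered map sends x to a
     series without constant term. *)
  have X0 : coefps (adams L p (fpsX R)) 0 = 0.
    have /xadic_idealP -> // : xadic R d 1 (adams L p (fpsX R)).
      apply/fF/xadic_idealP => j; rewrite add1n prednK // divnn hd.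
      by case: j.
    by rewrite add1n prednK // divnn hd.
  split=> //; first exact: filtered_morphism_compps.
  exact: (adams_frobenius LP).
(* The Adams operations are filtered and fix R, so the push-forward condition reduces to the value
   at x. *)
have pushE (f : {rmorphism universal -> R}) (L : filtered_lambda_structure
  (xadic R d)) p : prime p ->
    is_pushforward d f (fun F => compps F (universal_series p)) (adams L p) <->
    adams L p (fpsX R) = map_fps f (universal_series p).
  move=> pp; have [fm fC _ _ _] := adamsE L p pp.
  rewrite /is_pushforward comppsX ?universal_series0 //.
  by split=> [[] | e] //.
have L_inj (L M : filtered_lambda_structure (xadic R d)) :
    (forall p, prime p -> adams L p (fpsX R) = adams M p (fpsX R)) -> L = M.
  move=> LM; apply/filtered_lambda_structure_inj.
  apply: (lambda_ring_uniq tfRx (lambda_opP L) (lambda_opP M)) => p r pp.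
  have [_ _ _ Lp _] := adamsE L p pp; have [_ _ _ Mp _] := adamsE M p pp.
  by rewrite Lp Mp LM.
have ex (f : {rmorphism universal -> R}) : exists L : filtered_lambda_structure
  (xadic R d), forall p, prime p ->
    adams L p (fpsX R) = map_fps f (universal_series p).
  have G0 p : prime p -> coefps (map_fps f (universal_series p)) 0 = 0.
    by move=> pp; rewrite [LHS]/= -[RHS](rmorph0 f) -(universal_series0 pp).
  have [|L LE] := wilkerson (psi := fun p F => compps F (map_fps f
    (universal_series p))) tfRx satF.
    apply: compps_psi_structure => // [p pp | p q pp pq].
    + apply/natdvd_fpsP => n; rewrite coefpsB coefpsXn /= rmorphD rmorphM
        !rmorph_nat.
      by exists (f (universal_coordinate p n)); rewrite addrC addKr.
    + by rewrite -!map_fps_compps universal_series_comm.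
  by exists L => p pp; rewrite LE // comppsX // G0.
have [Psi PsiE] := choice ex.
exists Psi.
  split=> [f p pp | Psi' Psi'E]; first by apply/pushE => //; apply: PsiE.
  apply/funext => f; apply: L_inj => p pp; rewrite PsiE //.
  by apply/esym/pushE => //; apply: Psi'E.
have Psi_surj L : exists f, Psi f = L.
  have [p pp | p pp | p q pp pq | f fE] :=
    universal_hom_exists (G := fun p => adams L p (fpsX R)) iota_inj.
  - by have [] := adamsE L p pp.
  - by have [] := adamsE L p pp.
  (* The series commute because both composites are the Adams operation of index pq at x. *)
  - have [_ _ _ Lp _] := adamsE L p pp; have [_ _ _ Lq _] := adamsE L q pq.
    rewrite -Lq -Lp !(adams_comp tfRx (lambda_opP L)) ?prime_gt0 //.
    by rewrite mulnC.
  - by exists f; apply: L_inj => p pp; rewrite PsiE // fE.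
have [Phi PhiE] := choice Psi_surj.
exists Phi => // f; apply: (universal_hom_ext tfR) => p pp.
by rewrite -!PsiE // PhiE.
Qed.
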